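(* Let $X$ be a separable, infinite dimensional Banach space which is not uniformly finitely extensible. Then there is a subspace $Y$ of $X$ such that the relation $E_0$ is Borel reducible to $(\mathrm{Emb}(Y,X),\sim)$. In particular, the relation $\sim$ of position of $Y$ in $X$ is not smooth.
   Context: Subspaces are closed and infinite dimensional. A Banach space $X$ is uniformly finitely extensible (UFO) if there exists $\lambda\ge 1$ such that for every finite dimensional subspace $E\subset X$, each linear operator $t:E\to X$ may be extended to a linear operator $T:X\to X$ with $\|T\|\le\lambda\|t\|$. For infinite dimensional separable Banach spaces $Y,X$, $\mathcal B(Y,X)$ is the set of bounded linear operators from $Y$ to $X$, a standard Borel space for the Borel structure generated by the strong operator topology. $\mathrm{Emb}(Y,X)$ is the Borel subset of $\mathcal B(Y,X)$ of those operators that are isomorphisms onto a closed subspace of infinite codimension in $X$. $GL(X)$ is the group of (linear, bounded, boundedly invertible) automorphisms of $X$. On $\mathrm{Emb}(Y,X)$, $T\sim U$ iff there exists $A\in GL(X)$ with $T=AU$. An equivalence relation $R$ on a standard Borel space $E$ is Borel reducible to an equivalence relation $S$ on a standard Borel space $F$, written $(E,R)\le_B(F,S)$, if there is a Borel map $f:E\to F$ with $xRy\Leftrightarrow f(x)Sf(y)$ for all $x,y\in E$. An analytic equivalence relation is smooth if it is Borel reducible to $(\mathbb R,=)$. $E_0$ is the relation on $2^\omega$ given by $\alpha E_0\beta$ iff there is $m$ with $\alpha(n)=\beta(n)$ for all $n\ge m$. *)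

(* Defs.v *)
(* Banach spaces are taken over the reals. *)
From HB Require Import structures.
From mathcomp Require Import all_boot all_order all_algebra.
From mathcomp Require Import all_classical all_reals all_analysis.

Set Implicit Arguments.
Unset Strict Implicit.
Unset Printing Implicit Defensive.

Import Order.TTheory GRing.Theory Num.Theory.
Import numFieldNormedType.Exports.

Local Open Scope classical_set_scope.
Local Open Scope ring_scope.

Definition linspan (R : realType) (X : lmodType R) (n : nat) (e : 'I_n -> X) :
    set X :=
  [set \sum_(i < n) c i *: e i | c in [set: 'I_n -> R]].

Definition finite_dimensional (R : realType) (X : lmodType R) (V : set X) :
    Prop :=
  exists (n : nat) (e : 'I_n -> X), V = linspan e.

(* Finitely many classes [e i] span the quotient of X by V. *)
Definition finite_codimensional (R : realType) (X : lmodType R) (V : set X) :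
    Prop :=
  exists (n : nat) (e : 'I_n -> X),
    forall x, exists2 v, V v & linspan e (x - v).

Definition separable_space (T : topologicalType) : Prop :=
  exists2 D : set T, countable D & dense D.

(* Linear subspaces; closedness and (in)finite dimensionality are required
   separately where they are used. *)
Record lsubspace (R : realType) (X : normedModType R) := LSubspace {
  lsubspace_set :> set X;
  lsubspace_submod : submod_closed (mem lsubspace_set : {pred X})
}.

Definition lsubspace_pred (R : realType) (X : normedModType R)
  (V : lsubspace X) : {pred X} := mem (lsubspace_set V).

HB.instance Definition _ (R : realType) (X : normedModType R)
    (V : lsubspace X) :=
  GRing.isSubmodClosed.Build _ _ (lsubspace_pred V) (lsubspace_submod V).

(* A subspace V of X, as a normed space with the norm induced by X. *)
Record sub_space (R : realType) (X : normedModType R) (V : lsubspace X) :=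
  SubSpace { sub_incl : X; _ : sub_incl \in lsubspace_pred V }.

Section sub_space_normedModType.
Context (R : realType) (X : normedModType R) (V : lsubspace X).
Local Notation S := (sub_space V).

HB.instance Definition _ := [isSub for @sub_incl R X V].
HB.instance Definition _ := [Choice of S by <:].
HB.instance Definition _ := [SubChoice_isSubLmodule of S by <:].

Let nrm (v : S) : R := `|sub_incl v|.

Let nrmD (u v : S) : nrm (u + v) <= nrm u + nrm v.
Proof. exact: ler_normD. Qed.

Let nrmZ (a : R) (v : S) : nrm (a *: v) = `|a| * nrm v.
Proof. exact: normrZ. Qed.

Let nrm0_eq0 (v : S) : nrm v = 0 -> v = 0.
Proof. by move=> /normr0_eq0 v0; apply: val_inj. Qed.

HB.instance Definition _ :=
  @Lmodule_isNormed.Build R S nrm nrmD nrmZ nrm0_eq0.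

End sub_space_normedModType.

(* Extended-real valued, so that the norm of an unbounded operator is +oo. *)
Definition opnorm (R : realType) (Y X : normedModType R) (T : Y -> X) :
    \bar R :=
  ereal_sup [set `|T y|%:E | y in [set y : Y | `|y| <= 1]].

Definition UFO (R : realType) (X : normedModType R) : Prop :=
  exists2 lambda : R, 1 <= lambda &
    forall E : lsubspace X, finite_dimensional E ->
      forall t : {linear sub_space E -> X},
        exists2 T : {linear X -> X},
          forall x : sub_space E, T (sub_incl x) = t x &
          (opnorm T <= lambda%:E * opnorm t)%E.

Record bounded_op (R : realType) (Y X : normedModType R) := BoundedOp {
  bounded_op_linear :> {linear Y -> X};
  bounded_op_continuous : continuous bounded_op_linear
}.

Section strong_operator_topology.
Context (R : realType) (Y X : normedModType R).

HB.instance Definition _ := gen_eqMixin (bounded_op Y X).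
HB.instance Definition _ := gen_choiceMixin (bounded_op Y X).

(* The strong operator topology is the topology of pointwise convergence. *)
HB.instance Definition _ := Topological.copy (bounded_op Y X)
  (initial_topology (fun T : bounded_op Y X => (T : {ptws Y -> X}))).

End strong_operator_topology.

Definition isomorphism (R : realType) (Y X : normedModType R)
    (T : bounded_op Y X) : Prop :=
  exists S : bounded_op X Y, cancel T S /\ cancel S T.

Definition embedding (R : realType) (Y X : normedModType R)
    (T : bounded_op Y X) : Prop :=
  exists V : lsubspace X,
    [/\ closed (V : set X), ~ finite_codimensional V &
        exists2 T' : bounded_op Y (sub_space V),
          isomorphism T' & forall y, T y = sub_incl (T' y)].

(* As a subset of [bounded_op Y X], [Emb Y X] carries the subspace topology of
   the strong operator topology, whose Borel sets are the traces on [Emb Y X]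
   of the Borel sets of [bounded_op Y X]. *)
Definition Emb (R : realType) (Y X : normedModType R) : topologicalType :=
  set_type [set T : bounded_op Y X | embedding T].

Definition position (R : realType) (Y X : normedModType R) (T U : Emb Y X) :
    Prop :=
  exists2 A : bounded_op X X,
    isomorphism A &
    forall y, (val T : bounded_op Y X) y = A ((val U : bounded_op Y X) y).

Definition borel (T : topologicalType) : set (set T) := <<s @open T >>.

Definition borel_map (E F : topologicalType) (f : E -> F) : Prop :=
  forall B : set F, borel B -> borel (f @^-1` B).

Definition borel_reducible (E F : topologicalType)
    (r : E -> E -> Prop) (s : F -> F -> Prop) : Prop :=
  exists2 f : E -> F, borel_map f & forall x y, r x y <-> s (f x) (f y).

Definition smooth (R : realType) (E : topologicalType) (r : E -> E -> Prop) :
    Prop :=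
  borel_reducible r (@eq R).

Definition E0 (a b : cantor_space) : Prop :=
  exists m : nat, forall n : nat, (m <= n)%N -> a n = b n.

(* Main.v *)
(* Since X is not UFO, for every lambda some norm-one operator on a finite
   dimensional subspace has no extension of norm at most lambda.  Rank one
   corrections and Hahn-Banach show that its domain and range may be put in any
   prescribed subspace of finite codimension.  Hence one can choose inductively
   finite dimensional F_n, in general position, and s_n : F_n -> X of norm
   2^-(n+4) such that every extension of s_n to X has norm greater than n, the
   projections of Y = [F_n] onto the F_n being bounded by 4.  For a in 2^omega
   let T_a be the inclusion of Y plus the sum of a_n s_n P_n.  Functionals
   vanishing on all the F_n and s_n(F_n) keep the ranges of infinite
   codimension.  If a and b differ at finitely many places, T_a and T_b agree on
   a subspace of finite codimension in Y, hence differ by an automorphism of X.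
   If A T_b = T_a with a_n = 1 and b_n = 0, then A - id extends s_n, so its norm
   exceeds n; this can happen only finitely often.  Finally E_0 is not smooth
   because a Borel set is locally constant on a countable intersection of dense
   open sets, so an invariant Borel function is constant on such a set. *)

Require Import Defs.
From HB Require Import structures.
From mathcomp Require Import all_boot all_order all_algebra.
From mathcomp Require Import all_classical all_reals all_analysis.
From mathcomp Require Import ring lra.

Set Implicit Arguments.
Unset Strict Implicit.
Unset Printing Implicit Defensive.

Import Order.TTheory GRing.Theory Num.Theory.
Import numFieldNormedType.Exports.

Local Open Scope classical_set_scope.
Local Open Scope ring_scope.

(** That s_n is small and that its extensions are large are compatible demands because failure of
    extension scales: an operator with no extension of norm n/eps becomes, after multiplication by
    eps, one with no extension of norm n. The bound 4 arises because P_n is a difference of two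
    projections, each of norm at most 2 where it is used. Then 4 times 2^-(n+4) is 2^-(n+2), which
    sums to 1/2, so every T_a is bounded below by 1/2 on Y and has closed range. To leave room in X,
    each stage sets aside a vector z_n and a functional phi_n, and later domains and ranges are
    confined to the kernel of phi_n. In the code Y may exceed the closed span of the F_n: it is the
    closure of the set of vectors that meet the decomposition constraints of all stages, which makes
    the estimates on P_n immediate. Rank one corrections treat one functional at a time, which is
    why finite dimension and codimension are generated inductively. *)

Section module_tactic.
Context (R : comNzRingType) (X : lmodType R).

(** * Reflexive normalisation of vector identities *)

Inductive vexpr :=
| VAtom of nat
| VZero
| VAdd of vexpr & vexpr
| VOpp of vexpr
| VScale of R & vexpr.

Fixpoint veval (env : seq X) (e : vexpr) : X :=
  match e with
  | VAtom n => nth 0 env n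
  | VZero => 0
  | VAdd a b => veval env a + veval env b
  | VOpp a => - veval env a
  | VScale c a => c *: veval env a
  end.

(** The test is written with [eqn] so that [cbv] reduces it on numerals to a literal 0 or 1. *)
Fixpoint vcoef (n : nat) (e : vexpr) : R :=
  match e with
  | VAtom m => if eqn m n then 1 else 0
  | VZero => 0
  | VAdd a b => vcoef n a + vcoef n b
  | VOpp a => - vcoef n a
  | VScale c a => c * vcoef n a
  end.

Lemma veval_vcoef (env : seq X) (e : vexpr) :
  veval env e = \sum_(i < size env) vcoef i e *: env`_i.
Proof.
elim: e => [m||a IHa b IHb|a IHa|c a IHa] /=.
- have [lt_m|le_m] := ltnP m (size env).
    rewrite (bigD1 (Ordinal lt_m)) //= eqnE eqxx scale1r big1 ?addr0 // => i.
    by rewrite -val_eqE eq_sym => /negPf ->; rewrite scale0r.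
  rewrite nth_default // big1 // => i _; rewrite eqnE.
  by rewrite gtn_eqF ?scale0r // (leq_trans (ltn_ord i)).
- by rewrite big1 // => i _; rewrite scale0r.
- by rewrite IHa IHb -big_split; apply: eq_bigr => i _; rewrite scalerDl.
- by rewrite IHa -sumrN; apply: eq_bigr => i _; rewrite scaleNr.
- by rewrite IHa scaler_sumr; apply: eq_bigr => i _; rewrite scalerA.
Qed.

Fixpoint vcoef_eq (n : nat) (a b : vexpr) : Prop :=
  if n is m.+1 then vcoef m a = vcoef m b /\ vcoef_eq m a b else True.

Lemma veval_eq (env : seq X) (a b : vexpr) :
  vcoef_eq (size env) a b -> veval env a = veval env b.
Proof.
move=> ab; rewrite !veval_vcoef; apply: eq_bigr => -[i /= lt_i] _.
congr (_ *: _); elim: (size env) lt_i ab => // n IHn.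
by rewrite ltnS leq_eqVlt => /predU1P[-> []|/IHn IH [_ /IH]].
Qed.

End module_tactic.

Ltac vindex x l :=
  lazymatch l with
  | x :: _ => constr:(O)
  | _ :: ?l' => let n := vindex x l' in constr:(S n)
  end.

(** A failing [vindex] makes [match] fall through to the second branch, so each atom is listed
    once. *)
Ltac vinsert x l :=
  match l with
  | _ => let n := vindex x l in l
  | _ => constr:(x :: l)
  end.

Ltac vatoms t l :=
  lazymatch t with
  | (?a + ?b)%R => let l' := vatoms a l in vatoms b l'
  | (- ?a)%R => vatoms a l
  | (_ *: ?a)%R => vatoms a l
  | 0%R => l
  | _ => vinsert t l
  end.

Ltac vreify R t l :=
  lazymatch t with
  | (?a + ?b)%R =>
      let a' := vreify R a l in let b' := vreify R b l in
      constr:(@VAdd R a' b')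
  | (- ?a)%R => let a' := vreify R a l in constr:(@VOpp R a')
  | (?c *: ?a)%R => let a' := vreify R a l in constr:(@VScale R c a')
  | 0%R => constr:(@VZero R)
  | _ => let n := vindex t l in constr:(@VAtom R n)
  end.

(* Reduces an equation between linear combinations of vectors to one equation
   between scalars for each vector. *)
Ltac vcoefs R X :=
  lazymatch goal with
  | |- ?a = ?b =>
      let l0 := constr:(@nil X) in
      let l1 := vatoms a l0 in
      let l := vatoms b l1 in
      let a' := vreify R a l in
      let b' := vreify R b l in
      refine (@veval_eq R X l a' b' _);
      cbv [size vcoef_eq vcoef eqn];
      repeat split
  end.

Ltac vring R X := vcoefs R X; ring.

(** * Bounded operators and the Hahn-Banach theorem *)

Section subspaces.
Context (R : realType) (X : normedModType R).

(** Subspaces are bare sets and operators are total functions, linear or bounded only on a set;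
    passing to a smaller subspace then changes no types. *)
Definition subspace_set (V : set X) : Prop :=
  V 0 /\ forall a x y, V x -> V y -> V (a *: x + y).

Definition linear_on (W : normedModType R) (V : set X) (f : X -> W) : Prop :=
  forall a x y, V x -> V y -> f (a *: x + y) = a *: f x + f y.

Definition bounded_on (W : normedModType R) (V : set X) (M : R) (f : X -> W) :
    Prop :=
  forall x, V x -> `|f x| <= M * `|x|.

Definition bounded_linear (W : normedModType R) (f : X -> W) : Prop :=
  linear_on setT f /\ exists2 M, 0 <= M & bounded_on setT M f.

Definition addset (V W : set X) : set X :=
  [set x | exists v w, [/\ V v, W w & x = v + w]].

Definition addline (V : set X) (e : X) : set X :=
  [set x | exists v c, V v /\ x = v + c *: e].

Definition metric_closed (V : set X) : Prop :=
  forall x, (forall eps, 0 < eps -> exists2 v, V v & `|x - v| < eps) -> V x.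

Definition closure_of (V : set X) : set X :=
  [set x | forall eps, 0 < eps -> exists2 v, V v & `|x - v| < eps].

Section subspace_set_theory.
Variable V : set X.
Hypothesis sV : subspace_set V.

Lemma subspace_set0 : V 0. Proof. by case: sV. Qed.

Lemma subspace_setD x y : V x -> V y -> V (x + y).
Proof. by case: sV => _ VD Vx Vy; rewrite -[x]scale1r; exact: VD. Qed.

Lemma subspace_setZ a x : V x -> V (a *: x).
Proof. by case: sV => V0 VD Vx; rewrite -[_ *: _]addr0; exact: VD. Qed.

Lemma subspace_setN x : V x -> V (- x).
Proof. by rewrite -scaleN1r; exact: subspace_setZ. Qed.

Lemma subspace_setB x y : V x -> V y -> V (x - y).
Proof. by move=> Vx Vy; apply: subspace_setD => //; exact: subspace_setN. Qed.

Section linear_on_theory.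
Context (W : normedModType R) (f : X -> W).
Hypothesis fl : linear_on V f.

Lemma linear_on0 : f 0 = 0.
Proof.
have := fl 1 subspace_set0 subspace_set0; rewrite !scale1r addr0.
by move=> /esym/eqP; rewrite -subr_eq0 addrK => /eqP.
Qed.

Lemma linear_onD x y : V x -> V y -> f (x + y) = f x + f y.
Proof. by move=> Vx Vy; rewrite -[x in LHS]scale1r fl // scale1r. Qed.

Lemma linear_onZ a x : V x -> f (a *: x) = a *: f x.
Proof.
by move=> Vx; rewrite -[_ *: x]addr0 fl ?linear_on0 ?addr0 //; exact: subspace_set0.
Qed.

Lemma linear_onB x y : V x -> V y -> f (x - y) = f x - f y.
Proof.
move=> Vx Vy; rewrite -scaleN1r linear_onD ?linear_onZ ?scaleN1r //.
exact: subspace_setN.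
Qed.

End linear_on_theory.
End subspace_set_theory.

Lemma subspace_setT : subspace_set setT. Proof. by []. Qed.

Lemma subspace_set_zero : subspace_set [set 0].
Proof. by split => // a x y -> ->; rewrite scaler0 addr0. Qed.

Lemma subspace_setI V W : subspace_set V -> subspace_set W ->
  subspace_set (V `&` W).
Proof.
move=> sV sW; split; first by split; exact: subspace_set0.
by move=> a x y [Vx Wx] [Vy Wy]; split; [case: sV|case: sW] => _; apply.
Qed.

Lemma subspace_addset V W : subspace_set V -> subspace_set W ->
  subspace_set (addset V W).
Proof.
move=> sV sW; split.
  by exists 0, 0; split; rewrite ?addr0 //; exact: subspace_set0.
move=> a _ _ [v [w [Vv Ww ->]]] [v' [w' [Vv' Ww' ->]]].
exists (a *: v + v'), (a *: w + w'); split.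
- by case: sV => _; apply.
- by case: sW => _; apply.
- vring R X.
Qed.

Lemma subspace_addline V e : subspace_set V -> subspace_set (addline V e).
Proof.
move=> sV; split.
  by exists 0, 0; split; rewrite ?scale0r ?addr0 //; exact: subspace_set0.
move=> a _ _ [v [c [Vv ->]]] [v' [c' [Vv' ->]]].
exists (a *: v + v'), (a * c + c'); split; first by case: sV => _; apply.
vring R X.
Qed.

Lemma subset_addline V e : V `<=` addline V e.
Proof. by move=> v Vv; exists v, 0; rewrite scale0r addr0. Qed.

Lemma mem_addline V e : subspace_set V -> addline V e e.
Proof.
move=> sV; exists 0, 1; rewrite scale1r add0r; split => //.
exact: subspace_set0.
Qed.

Lemma subset_closure_of V : V `<=` closure_of V.
Proof. by move=> v Vv eps e0; exists v; rewrite ?subrr ?normr0. Qed.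

Lemma closure_of_closed V : metric_closed (closure_of V).
Proof.
move=> x xV eps e0; have e20 : 0 < eps / 2 by rewrite divr_gt0.
have [v Vv xv] := xV _ e20; have [w Vw vw] := Vv _ e20.
exists w => //; apply: le_lt_trans (ler_distD v _ _) _.
by rewrite [ltRHS]splitr; exact: ltrD.
Qed.

Lemma subspace_closure_of V : subspace_set V -> subspace_set (closure_of V).
Proof.
move=> sV; split; first by apply: subset_closure_of; exact: subspace_set0.
move=> a x y xV yV eps e0.
(* Dividing by 1 + |a| rather than |a| covers a = 0. *)
have a0 : 0 < 1 + `|a| by rewrite ltr_pwDl.
have [v Vv xv] := xV (eps / 2 / (1 + `|a|)) ltac:(by rewrite !divr_gt0).
have [w Vw yw] := yV (eps / 2) ltac:(by rewrite !divr_gt0).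
exists (a *: v + w); first by case: sV => _; apply.
have -> : a *: x + y - (a *: v + w) = a *: (x - v) + (y - w) by vring R X.
apply: le_lt_trans (ler_normD _ _) _.
rewrite [ltRHS]splitr; apply: ler_ltD => //; rewrite normrZ.
have /ltW xv' := xv; apply: le_trans (ler_wpM2l _ xv') _ => //.
rewrite mulrCA ler_piMr //; first by rewrite ltW // divr_gt0.
by rewrite ler_pdivrMr // mul1r lerDr.
Qed.

Lemma closedP (V : set X) : closed V <-> metric_closed V.
Proof.
split => [cV x xV|cV x xV].
  apply: cV => B /nbhs_ballP[e /= e0 Be].
  have [v Vv xv] := xV _ e0; exists v; split => //.
  by apply: Be; rewrite -ball_normE.
apply: cV => e e0.
have [|v [Vv xv]] := xV (ball x e); first exact: nbhsx_ballx.
by exists v => //; move: xv; rewrite -ball_normE.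
Qed.

Section bounded_linear_theory.
Context (W : normedModType R) (f : X -> W).
Hypothesis fb : bounded_linear f.

Lemma blinP a x y : f (a *: x + y) = a *: f x + f y.
Proof. by case: fb => fl _; exact: fl. Qed.

Lemma blin0 : f 0 = 0.
Proof. by case: fb => fl _; exact: (linear_on0 subspace_setT fl). Qed.

Lemma blinD x y : f (x + y) = f x + f y.
Proof. by case: fb => fl _; exact: (linear_onD fl). Qed.

Lemma blinZ a x : f (a *: x) = a *: f x.
Proof. by case: fb => fl _; exact: (linear_onZ subspace_setT fl). Qed.

Lemma blinB x y : f (x - y) = f x - f y.
Proof. by case: fb => fl _; exact: (linear_onB subspace_setT fl). Qed.

Lemma blin_bound : exists2 M, 0 < M & forall x, `|f x| <= M * `|x|.
Proof.
case: fb => _ [M M0 fM]; exists (M + 1); first by rewrite ltr_wpDl.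
by move=> x; apply: le_trans (fM _ I) _; rewrite ler_wpM2r // lerDl.
Qed.

Lemma blin_sub V : linear_on V f.
Proof. by move=> a x y _ _; exact: blinP. Qed.

Lemma subspace_ker : subspace_set [set x | f x = 0].
Proof.
by split => [|a x y /= fx fy]; rewrite /= ?blin0 // blinP fx fy scaler0 addr0.
Qed.

Lemma closure_of_bounded V M : 0 <= M -> bounded_on V M f ->
  bounded_on (closure_of V) M f.
Proof.
move=> M0 fM x xV; apply/ler_addgt0Pr => e e0.
have [N N0 fN] := blin_bound.
have NM : 0 < N + M by rewrite ltr_pwDl.
(* This radius absorbs both errors: |f (x - v)| <= N |x - v| and |v| <= |x| + |x - v|. *)
have [v Vv xv] := xV (e / (N + M)) ltac:(by rewrite divr_gt0).
have -> : f x = f (x - v) + f v by rewrite blinB subrK.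
apply: le_trans (ler_normD _ _) _.
have vx : `|v| <= `|x| + `|x - v|.
  by have := ler_normD x (v - x); rewrite addrC subrK distrC.
have := fM _ Vv; have := fN (x - v).
have : `|x - v| * (N + M) < e by rewrite -ltr_pdivlMr.
by nra.
Qed.

Lemma closure_of_ker V : (forall x, V x -> f x = 0) ->
  forall x, closure_of V x -> f x = 0.
Proof.
move=> f0 x xV; apply/normr0_eq0/le_anti; rewrite normr_ge0 andbT.
rewrite -[leRHS](mul0r `|x|); apply: (closure_of_bounded _ _ xV) => //.
by move=> v Vv; rewrite f0 // normr0 mul0r.
Qed.

End bounded_linear_theory.

Lemma blin_scalar (f : X -> R) : bounded_linear f ->
  forall a x, f (a *: x) = a * f x.
Proof. by move=> fb a x; rewrite (blinZ fb). Qed.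

Lemma blin_id : bounded_linear (@id X).
Proof. by split => //; exists 1 => // x _; rewrite mul1r. Qed.

Lemma blin_cst0 (W : normedModType R) : bounded_linear (fun _ : X => 0 : W).
Proof.
by split => [a x y _ _|]; [rewrite scaler0 addr0|exists 0 => // x _; rewrite normr0 mul0r].
Qed.

Lemma blin_add (W : normedModType R) (f g : X -> W) : bounded_linear f ->
  bounded_linear g -> bounded_linear (fun x => f x + g x).
Proof.
move=> fb gb; split; first by move=> a x y _ _; rewrite !blinP //; vring R W.
have [M M0 fM] := blin_bound fb; have [N N0 gN] := blin_bound gb.
exists (M + N) => [|x _]; first by rewrite addr_ge0 // ltW.
by apply: le_trans (ler_normD _ _) _; rewrite mulrDl lerD.
Qed.

Lemma blin_scale (W : normedModType R) (c : R) (f : X -> W) :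
  bounded_linear f -> bounded_linear (fun x => c *: f x).
Proof.
move=> fb; split; first by move=> a x y _ _; rewrite !blinP //; vring R W.
have [M M0 fM] := blin_bound fb.
exists (`|c| * M) => [|x _]; first by rewrite mulr_ge0 // ltW.
by rewrite normrZ -mulrA ler_wpM2l.
Qed.

Lemma blin_sub2 (W : normedModType R) (f g : X -> W) : bounded_linear f ->
  bounded_linear g -> bounded_linear (fun x => f x - g x).
Proof.
move=> fb gb; apply: blin_add => //.
under eq_fun do rewrite -scaleN1r.
exact: blin_scale.
Qed.

Lemma blin_rank1 (W : normedModType R) (f : X -> R) (w : W) :
  bounded_linear f -> bounded_linear (fun x => f x *: w).
Proof.
move=> fb; split => [a x y _ _|].
  by rewrite !blinP // scalerDl -scalerA.
have [M M0 fM] := blin_bound fb.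
exists (M * `|w|) => [|x _]; first by rewrite mulr_ge0 // ltW.
by rewrite normrZ mulrAC ler_wpM2r.
Qed.

End subspaces.

Lemma blin_comp (R : realType) (X Y Z : normedModType R) (f : X -> Y)
    (g : Y -> Z) :
  bounded_linear f -> bounded_linear g -> bounded_linear (g \o f).
Proof.
move=> fb gb; split => [a x y _ _|]; first by rewrite /= !blinP.
have [M M0 fM] := blin_bound fb; have [N N0 gN] := blin_bound gb.
exists (N * M) => [|x _ /=]; first by rewrite mulr_ge0 // ltW.
by apply: le_trans (gN _) _; rewrite -mulrA ler_pM2l.
Qed.

Section hahn_banach.
Context (R : realType) (X : normedModType R) (M : R).

Let good (G : set (X * R)) :=
  (forall a p q, G p -> G q -> G (a *: p.1 + q.1, a * p.2 + q.2)) /\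
  (forall p, G p -> p.2 <= M * `|p.1|).

(** A value r at x0 is admissible when it lies between all p.2 - M |p.1 - x0| and all M |q.1 + x0| -
    q.2. The triangle inequality puts each lower bound below each upper bound, so the supremum of
    the lower ones serves. *)
Lemma hahn_banach_step (G : set (X * R)) (x0 : X) : 0 <= M -> G (0, 0) -> good G ->
  (forall r, ~ G (x0, r)) ->
  exists G', [/\ good G', G `<=` G' & exists r, G' (x0, r)].
Proof.
move=> M0 G0 [Gl Gb] Gx0.
pose L := [set r | exists2 p, G p & r = p.2 - M * `|p.1 - x0|].
have LU p q : G p -> G q -> p.2 - M * `|p.1 - x0| <= M * `|q.1 + x0| - q.2.
  move=> Gp Gq; have := Gb _ (Gl 1 _ _ Gp Gq); rewrite /= scale1r mul1r => pq.
  have : `|p.1 + q.1| <= `|p.1 - x0| + `|q.1 + x0|.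
    rewrite (_ : p.1 + q.1 = (p.1 - x0) + (q.1 + x0)) ?ler_normD //.
    vring R X.
  by nra.
have supL : has_sup L.
  split; first by exists (0 - M * `|0 - x0|); exists (0, 0).
  by exists (M * `|0 + x0| - 0) => _ [p Gp ->]; exact: LU Gp G0.
pose r := sup L.
have rl p : G p -> p.2 - M * `|p.1 - x0| <= r.
  by move=> Gp; apply: ub_le_sup; [case: supL|exists p].
have ru q : G q -> r <= M * `|q.1 + x0| - q.2.
  by move=> Gq; apply: ge_sup; [case: supL|move=> _ [p Gp ->]; exact: LU].
exists [set p | exists q t, G q /\ p = (q.1 + t *: x0, q.2 + t * r)]; split.
- split.
    move=> a _ _ [p [t [Gp ->]]] [q [s [Gq ->]]] /=.
    exists (a *: p.1 + q.1, a * p.2 + q.2), (a * t + s); split; first exact: Gl.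
    by rewrite /=; congr pair; [vring R X|ring].
  move=> _ [q [t [Gq ->]]] /=.
  (* Division by |t| reduces negative t to [rl] and positive t to [ru]. *)
  have [t0|t0|->] := ltgtP t 0; last by rewrite scale0r mul0r !addr0; exact: Gb.
  + have := rl _ (Gl (- t)^-1 _ _ Gq G0); rewrite /= !addr0 => H.
    have -> : q.1 + t *: x0 = (- t) *: ((- t)^-1 *: q.1 - x0).
      by vcoefs R X; field; rewrite ?lt_eqF.
    rewrite normrZ gtr0_norm ?oppr_gt0 //.
    have : (- t) * ((- t)^-1 * q.2 - M * `|(- t)^-1 *: q.1 - x0|) <= - t * r.
      by rewrite ler_pM2l ?oppr_gt0.
    by rewrite mulrBr mulrA mulfV ?oppr_eq0 ?lt_eqF //; lra.
  + have := ru _ (Gl t^-1 _ _ Gq G0); rewrite /= !addr0 => H.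
    have -> : q.1 + t *: x0 = t *: (t^-1 *: q.1 + x0).
      by vcoefs R X; field; rewrite ?gt_eqF.
    rewrite normrZ gtr0_norm //.
    have : t * r <= t * (M * `|t^-1 *: q.1 + x0| - t^-1 * q.2).
      by rewrite ler_pM2l.
    by rewrite mulrBr [t * (t^-1 * _)]mulrA mulfV ?gt_eqF //; lra.
- by move=> [x a] Gx; exists (x, a), 0; rewrite /= scale0r mul0r !addr0.
- exists r; exists (0, 0), 1.
  by rewrite /= scale1r mul1r !add0r.
Qed.

(* The functional is given by its graph G, single-valued because of the bound. *)
Theorem hahn_banach_graph (G : set (X * R)) : 0 <= M -> G (0, 0) -> good G ->
  exists f : X -> R, [/\ linear_on setT f, bounded_on setT M f &
    forall x r, G (x, r) -> f x = r].
Proof.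
move=> M0 G0 gG.
(* The guard [A !=set0] lets [P] hold of the empty set, the union of the empty chain; a maximal
   element is nonempty because [G] would exceed it. *)
pose P A := good A /\ (A !=set0 -> G `<=` A).
have [F FP Ftot|A [[[Al Ab] GA] Amax]] := @Zorn_bigcup _ P.
  split; last first.
    move=> [p [A FA Ap]]; apply: subset_trans (bigcup_sup FA).
    by case: (FP _ FA) => _; apply; exists p.
  split; last by move=> p [A FA Ap]; have [[_ Ab] _] := FP _ FA; exact: Ab.
  move=> a p q [A FA Ap] [B FB Bq].
  have [AB|BA] := Ftot _ _ FA FB.
    by exists B => //; have [[Bl _] _] := FP _ FB; apply: Bl => //; exact: AB.
  by exists A => //; have [[Al _] _] := FP _ FA; apply: Al => //; exact: BA.
have {}GA : G `<=` A.
  apply: GA; apply/set0P/negP => /eqP A0.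
  apply: (Amax G); last by split=> // _; exact: subset_refl.
  by rewrite A0; split => [? []|/(_ _ G0)].
have A0 := GA _ G0.
have Atot x : exists r, A (x, r).
  apply: contrapT => /forallNP Ax.
  have [A' [gA' AA' [r A'x]]] := hahn_banach_step M0 A0 (conj Al Ab) Ax.
  apply: (Amax A').
    by split => // /(_ _ A'x); exact: Ax.
  by split => // _; exact: subset_trans AA'.
have [f fA] := choice Atot.
have Auniq x r s : A (x, r) -> A (x, s) -> r = s.
  have le r' s' : A (x, r') -> A (x, s') -> r' <= s'.
    move=> Ar As; have := Ab _ (Al (-1) _ _ As Ar).
    by rewrite /= scaleN1r addNr normr0 mulr0; lra.
  by move=> Ar As; apply/le_anti; rewrite !le.
exists f; split.
- move=> a x y _ _; apply: Auniq (fA _) _.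
  exact: (Al a _ _ (fA x) (fA y)).
- move=> x _; rewrite ler_norml (Ab _ (fA x)) andbT lerNl.
  have := Ab _ (Al (-1) _ _ (fA x) A0).
  by rewrite /= !addr0 mulN1r scaleN1r normrN.
- by move=> x r /GA; exact: Auniq (fA x).
Qed.

End hahn_banach.

Section hahn_banach_corollaries.
Context (R : realType) (X : normedModType R).

Lemma hahn_banach (V : set X) (f : X -> R) (M : R) : 0 <= M ->
  subspace_set V -> linear_on V f -> bounded_on V M f ->
  exists2 g : X -> R, linear_on setT g /\ bounded_on setT M g &
    forall x, V x -> g x = f x.
Proof.
move=> M0 sV fl fM.
have [||g [gl gM gG]] :=
    @hahn_banach_graph R X M [set p | V p.1 /\ p.2 = f p.1] M0.
- by split => /=; [exact: subspace_set0|rewrite (linear_on0 sV fl)].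
- split=> [a p q [Vp ->] [Vq ->]|p [Vp ->]] /=.
    by rewrite fl //; split=> //; case: sV => _; exact.
  exact: le_trans (ler_norm _) (fM _ Vp).
- by exists g => // x Vx; exact: gG.
Qed.

Lemma norming_functional (x : X) : exists2 f : X -> R,
  bounded_linear f /\ bounded_on setT 1 f & f x = `|x|.
Proof.
have [||f [fl f1 fG]] := @hahn_banach_graph R X 1
  [set p | exists c, p = (c *: x, c * `|x|)] ler01.
- by exists 0; rewrite scale0r mul0r.
- split=> [a _ _ [c ->] [d ->]|_ [c ->]] /=.
    by exists (a * c + d); rewrite scalerDl scalerA; congr pair; ring.
  by rewrite mul1r normrZ ler_wpM2r // ler_norm.
- exists f; first by split=> //; split => //; exists 1.
  by apply: fG; exists 1; rewrite scale1r mul1r.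
Qed.

(** If d > 0 is a lower bound for the distance from x to V, then |v + c x| >= |c| d, so v + c x |->
    c has norm at most 1/d and extends. *)
Lemma separating_functional (V : set X) (x : X) : subspace_set V ->
  metric_closed V -> ~ V x ->
  exists f : X -> R, [/\ bounded_linear f, forall v, V v -> f v = 0 & f x = 1].
Proof.
move=> sV cV Vx.
have [d d0 xd] : exists2 d, 0 < d & forall v, V v -> d <= `|x - v|.
  apply: contrapT => H; apply: Vx; apply: cV => e e0; apply: contrapT => H'.
  apply: H; exists e => // v Vv; rewrite leNgt; apply/negP => xv.
  by apply: H'; exists v.
have M0 : 0 <= d^-1 by rewrite invr_ge0 ltW.
have [||f [fl fM fG]] := @hahn_banach_graph R X d^-1
  [set p | exists2 v, V v & p.1 = v + p.2 *: x] M0.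
- by exists 0; [exact: subspace_set0|rewrite scale0r addr0].
- split=> [a [p s] [q t] /= [v Vv ->] [w Vw ->]|[p c] /= [v Vv ->]].
    exists (a *: v + w); first by case: sV => _; apply.
    vring R X.
  have [c0|c0] := leP c 0; first by rewrite (le_trans c0) // mulr_ge0.
  have -> : v + c *: x = c *: (x - (- c^-1) *: v).
    by vcoefs R X; field; rewrite gt_eqF.
  rewrite normrZ gtr0_norm // mulrCA ler_pMr // mulrC ler_pdivlMr // mul1r.
  by apply: xd; exact: subspace_setZ.
- exists f; split; first by split => //; exists d^-1.
    by move=> v Vv; apply: fG; exists v; rewrite //= scale0r addr0.
  by apply: fG; exists 0; [exact: subspace_set0|rewrite /= scale1r add0r].
Qed.

End hahn_banach_corollaries.

(** * Subspaces of finite dimension or codimension *)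

Section finite_dimension.
Context (R : realType) (X : normedModType R).

(** Each new vector lies outside the closed subspace already reached, so a bounded functional reads
    off its coordinate. *)
Inductive fdim : set X -> Prop :=
| fdim_zero : fdim [set 0]
| fdim_step V e : fdim V -> ~ V e -> fdim (addline V e).

(** Finite intersections of kernels of bounded functionals, one functional per step of an
    induction. *)
Inductive fcod : set X -> Prop :=
| fcodT : fcod setT
| fcod_ker Z (f : X -> R) : fcod Z -> bounded_linear f ->
    fcod (Z `&` [set x | f x = 0]).

Lemma fdim_subspace V : fdim V -> subspace_set V.
Proof.
elim=> [|{}V e _ sV _]; first exact: subspace_set_zero.
exact: subspace_addline.
Qed.

Lemma fcod_subspace Z : fcod Z -> subspace_set Z.
Proof.
elim=> [|{}Z f _ sZ fb]; first exact: subspace_setT.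
by apply: subspace_setI => //; exact: subspace_ker.
Qed.

Lemma fcodI Z Z' : fcod Z -> fcod Z' -> fcod (Z `&` Z').
Proof.
move=> cZ; elim=> [|{}Z' f _ IH fb]; first by rewrite setIT.
by rewrite setIA; exact: fcod_ker.
Qed.

Lemma closed_preimage_blin V (g : X -> X) : metric_closed V ->
  bounded_linear g -> metric_closed [set x | V (g x)].
Proof.
move=> cV gb x xV; apply: cV => e e0; have [M M0 gM] := blin_bound gb.
have [v Vv xv] := xV (e / M) ltac:(by rewrite divr_gt0).
exists (g v) => //; rewrite -blinB //; apply: le_lt_trans (gM _) _.
by rewrite mulrC -ltr_pdivlMr.
Qed.

(** With [h] vanishing on V and h e = 1, the enlarged space is the preimage of V under the bounded
    map x - h x e. *)
Lemma addline_closed (V : set X) (e : X) : subspace_set V -> metric_closed V -> ~ V e ->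
  metric_closed (addline V e).
Proof.
move=> sV cV Ve; have [h [hb hV he]] := separating_functional sV cV Ve.
have -> : addline V e = [set x | V (x - h x *: e)].
  apply/seteqP; split => [_ [v [c [Vv ->]]]|x /= Vx].
    rewrite /= (blinD hb) (blinZ hb) hV // he add0r.
    by rewrite (_ : c *: 1 = c) ?addrK //; exact: mulr1.
  by exists (x - h x *: e), (h x); rewrite subrK.
apply: closed_preimage_blin => //; apply: blin_sub2; first exact: blin_id.
exact: blin_rank1.
Qed.

Lemma set0_closed : metric_closed [set 0 : X].
Proof.
move=> x x0; apply/normr0_eq0/le_anti; rewrite normr_ge0 andbT.
apply/ler_addgt0Pr => e e0; rewrite add0r.
by have [_ -> xe] := x0 _ e0; rewrite -[x]subr0 ltW.
Qed.

Lemma fdim_closed V : fdim V -> metric_closed V.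
Proof.
elim=> [|{}V e fV cV Ve]; first exact: set0_closed.
by apply: addline_closed => //; exact: fdim_subspace.
Qed.

Lemma fdim_addline V e : fdim V -> fdim (addline V e).
Proof.
move=> fV; have [Ve|Ve] := pselect (V e); last exact: fdim_step.
suff -> : addline V e = V by [].
apply/seteqP; split; last exact: subset_addline.
have sV := fdim_subspace fV.
by move=> _ [v [c [Vv ->]]]; apply: subspace_setD => //; exact: subspace_setZ.
Qed.

Lemma fdim_addset V W : fdim V -> fdim W -> fdim (addset V W).
Proof.
move=> fV; elim=> [|{}W e fW IH We].
  suff -> : addset V [set 0] = V by [].
  apply/seteqP; split; first by move=> _ [v [_ [Vv -> ->]]]; rewrite addr0.
  by move=> v Vv; exists v, 0; rewrite addr0.
suff -> : addset V (addline W e) = addline (addset V W) e.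
  exact: fdim_addline.
apply/seteqP; split.
  move=> _ [v [_ [Vv [w [c [Ww ->]]] ->]]].
  by exists (v + w), c; rewrite addrA; split => //; exists v, w.
move=> _ [_ [c [[v [w [Vv Ww ->]]] ->]]].
by exists v, (w + c *: e); rewrite addrA; split => //; exists w, c.
Qed.

Lemma fdim_sub V W : fdim V -> subspace_set W -> W `<=` V -> fdim W.
Proof.
move=> fV; elim: fV W => [|{}V e fV IH Ve] W sW WV.
  suff -> : W = [set 0] by exact: fdim_zero.
  by apply/seteqP; split => // _ ->; exact: subspace_set0.
have sV := fdim_subspace fV.
have fWV : fdim (W `&` V) by apply: IH => [|x []//]; exact: subspace_setI.
have [sub|] := pselect (W `<=` V); first by rewrite -(setIidl sub).
move=> /existsNP[w0 /not_implyP[Ww0 Vw0]].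
suff -> : W = addline (W `&` V) w0 by exact: fdim_addline.
apply/seteqP; split => [x Wx|_ [v [c [[Wv _] ->]]]]; last first.
  by apply: subspace_setD => //; exact: subspace_setZ.
have [v [c [Vv xE]]] := WV _ Wx; have [v0 [c0 [Vv0 w0E]]] := WV _ Ww0.
have c00 : c0 != 0.
  by apply: contra_notN Vw0 => /eqP c00; rewrite w0E c00 scale0r addr0.
(* This multiple of [w0] cancels the e-coordinate of x, so the difference falls into V. *)
exists (x - (c / c0) *: w0), (c / c0); split; last by rewrite subrK.
split; first by apply: subspace_setB => //; exact: subspace_setZ.
suff -> : x - (c / c0) *: w0 = v - (c / c0) *: v0.
  by apply: subspace_setB => //; exact: subspace_setZ.
by rewrite xE w0E; vcoefs R X; field.
Qed.

Lemma fdim_image V (f : X -> X) : fdim V -> linear_on V f -> fdim (f @` V).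
Proof.
elim=> [fl|{}V e fV IH Ve fl].
  suff -> : f @` [set 0] = [set 0] by exact: fdim_zero.
  by rewrite image_set1 (linear_on0 (@subspace_set_zero _ _) fl).
have sV := fdim_subspace fV; have sVe := subspace_addline e sV.
have VVe := @subset_addline _ _ V e; have Vee := mem_addline e sV.
suff -> : f @` addline V e = addline (f @` V) (f e).
  apply/fdim_addline/IH => a x y Vx Vy.
  by apply: fl; exact: VVe.
have fE v c : V v -> f (v + c *: e) = f v + c *: f e.
  move=> Vv; rewrite (linear_onD fl) ?(linear_onZ sVe fl) //; first exact: VVe.
  exact: subspace_setZ.
apply/seteqP; split.
  by move=> _ [_ [v [c [Vv ->]]] <-]; exists (f v), c; rewrite fE //; split=> //; exists v.
move=> _ [_ [c [[v Vv <-] ->]]]; exists (v + c *: e); last by rewrite fE.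
by exists v, c.
Qed.

Lemma linspan_recr (n : nat) (e : 'I_n.+1 -> X) :
  linspan e = addline (linspan (fun i => e (lift ord_max i))) (e ord_max).
Proof.
have wE (i : 'I_n) : widen_ord (leqnSn n) i = lift ord_max i.
  by apply: val_inj; rewrite /= /bump leqNgt ltn_ord.
apply/seteqP; split => [_ [c _ <-]|_ [_ [d [[c _ <-] ->]]]].
  rewrite big_ord_recr /=; eexists; exists (c ord_max); split; last by [].
  exists (fun i => c (lift ord_max i)) => //.
  by apply: eq_bigr => i _; rewrite wE.
exists (fun i : 'I_n.+1 => if unlift ord_max i is Some j then c j else d) => //.
rewrite big_ord_recr /= unlift_none; congr (_ + _); apply: eq_bigr => i _.
by rewrite wE liftK.
Qed.

Lemma fdim_finite_dimensional V : fdim V <-> finite_dimensional V.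
Proof.
split=> [|[n [e ->]]]; last first.
  elim: n e => [|n IH] e; last by rewrite linspan_recr; exact: fdim_addline.
  suff -> : linspan e = [set 0] by exact: fdim_zero.
  apply/seteqP; split => [_ [c _ <-]|_ ->]; first by rewrite big_ord0.
  by exists (fun=> 0) => //; rewrite big_ord0.
elim=> [|{}V e _ [n [b ->]] _].
  exists 0, (fun=> 0); apply/seteqP; split => [_ ->|_ [c _ <-]].
    by exists (fun=> 0) => //; rewrite big_ord0.
  by rewrite big_ord0.
exists n.+1, (fun i => if unlift ord_max i is Some j then b j else e).
rewrite linspan_recr unlift_none; congr (addline (linspan _) _).
by apply/funext => i; rewrite liftK.
Qed.

(** The e-coordinate is split off by a functional before the previous projection is applied; the
    functional joins those that cut out Z. *)
Lemma fdim_projection V : fdim V -> exists2 Q : X -> X, bounded_linear Q &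
  [/\ forall x, V (Q x), forall v, V v -> Q v = v &
      exists2 Z, fcod Z & forall z, Z z -> Q z = 0].
Proof.
elim=> [|{}V e fV [Q Qb [QV Qid [Z fZ QZ]]] Ve].
  exists (fun=> 0); first exact: blin_cst0.
  by split=> //; exists setT => //; exact: fcodT.
have sV := fdim_subspace fV.
have [h [hb hV he]] := separating_functional sV (fdim_closed fV) Ve.
exists (fun x => Q (x - h x *: e) + h x *: e).
  apply: blin_add; last exact: blin_rank1.
  apply: (@blin_comp _ _ _ _ (fun x => x - h x *: e)) => //.
  by apply: blin_sub2; [exact: blin_id|exact: blin_rank1].
split=> [x|_ [v [c [Vv ->]]]|].
- by exists (Q (x - h x *: e)), (h x).
- have -> : h (v + c *: e) = c by rewrite blinD // blinZ // hV // he add0r; exact: mulr1.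
  by rewrite addrK Qid.
- exists (Z `&` [set x | h x = 0]); first exact: fcod_ker.
  by move=> z [Zz /= ->]; rewrite scale0r subr0 addr0 QZ.
Qed.

Lemma interval_net (r eps : R) : 0 < eps -> exists s : seq R,
  forall c, `|c| <= r -> exists2 d, d \in s & `|c - d| <= eps.
Proof.
move=> e0.
have [n rn] : exists n : nat, r <= n%:R * eps.
  exists (Num.bound `|r / eps|); rewrite -ler_pdivrMr //.
  by apply: le_trans (ler_norm _) _; rewrite ltW // archi_boundP.
suff [s sP] : exists s : seq R, forall c, `|c| <= n%:R * eps ->
    exists2 d, d \in s & `|c - d| <= eps.
  by exists s => c cr; apply: sP; exact: le_trans rn.
elim: n {rn} => [|n [s sP]].
  exists [:: 0] => c; rewrite mul0r normr_le0 => /eqP ->.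
  by exists 0; rewrite ?mem_seq1 // subr0 normr0 ltW.
exists [:: n%:R * eps, - (n%:R * eps) & s] => c cn.
have [/sP[d ds cd]|nc] := leP `|c| (n%:R * eps).
  by exists d => //; rewrite !inE ds !orbT.
move: cn; rewrite -natr1 mulrDl mul1r => cn.
have [c0|c0] := leP 0 c.
  move: nc cn; rewrite ger0_norm // => nc cn.
  exists (n%:R * eps); first by rewrite !inE eqxx.
  by rewrite ger0_norm ?subr_ge0; lra.
move: nc cn; rewrite ltr0_norm // => nc cn.
exists (- (n%:R * eps)); first by rewrite !inE eqxx orbT.
by rewrite ler0_norm; lra.
Qed.

Lemma fdim_net V : fdim V -> forall r eps : R, 0 < eps -> exists s : seq X,
  forall v, V v -> `|v| <= r -> exists2 x, x \in s & `|v - x| < eps.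
Proof.
elim=> [|{}V e fV IH Ve] r eps e0.
  by exists [:: 0] => _ -> _; exists 0; rewrite ?mem_seq1 // subr0 normr0.
have sV := fdim_subspace fV.
have [h [hb hV he]] := separating_functional sV (fdim_closed fV) Ve.
have [M M0 hM] := blin_bound hb.
have e1 : 0 < 1 + `|e| by rewrite ltr_pwDl.
(* If |v + c e| <= r then |c| <= M r, hence |v| <= r + M r |e|. The tolerance is halved between the
   two coordinates. *)
have [s sP] := IH (r + M * r * `|e|) (eps / 2) ltac:(by rewrite divr_gt0).
have [t tP] := @interval_net (M * r) (eps / 2 / (1 + `|e|))
  ltac:(by rewrite !divr_gt0).
exists [seq v + c *: e | v <- s, c <- t] => _ [v [c [Vv ->]]] vr.
have hE : h (v + c *: e) = c.
  by rewrite blinD // blinZ // hV // he add0r; exact: mulr1.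
have cM : `|c| <= M * r by rewrite -hE (le_trans (hM _)) // ler_pM2l.
have [d dt cd] := tP _ cM.
have [|x xs vx] := sP _ Vv.
  have -> : v = (v + c *: e) - c *: e by rewrite addrK.
  by apply: le_trans (ler_normB _ _) _; rewrite lerD // normrZ ler_wpM2r.
exists (x + d *: e); first by apply/allpairsP; exists (x, d).
have -> : v + c *: e - (x + d *: e) = (v - x) + (c - d) *: e by vring R X.
apply: le_lt_trans (ler_normD _ _) _; rewrite [ltRHS]splitr.
apply: ltr_leD => //; rewrite normrZ.
apply: le_trans (ler_wpM2r _ cd) _ => //.
rewrite mulrC mulrCA ler_piMr //; first by rewrite ltW // divr_gt0.
by rewrite ler_pdivrMr // mul1r lerDr.
Qed.

(* Mazur's lemma: the functionals norming the points of a fine net of the unit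
   ball of V almost norm V. *)
Lemma fdim_norming V : fdim V -> exists2 Z, fcod Z &
  forall v z, V v -> Z z -> `|v| <= 2 * `|v + z|.
Proof.
move=> fV; have sV := fdim_subspace fV.
(* For a unit vector u within 1/4 of x, and f norming x, f u >= |x| - 1/4 >= 1/2; since f kills Z
   this bounds |u + w| below by 1/2. *)
have [s sP] := @fdim_net _ fV 1 4^-1 ltac:(by rewrite invr_gt0).
have [Z fZ ZP] : exists2 Z, fcod Z & forall x z, x \in s -> Z z ->
    exists2 f : X -> R, bounded_linear f /\ bounded_on setT 1 f &
    f x = `|x| /\ f z = 0.
  elim: s {sP} => [|x s [Z fZ ZP]]; first by exists setT => //; exact: fcodT.
  have [f [fb f1] fx] := norming_functional x.
  exists (Z `&` [set x | f x = 0]); first exact: fcod_ker.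
  move=> x' z; rewrite inE => /predU1P[-> [_ /= fz]|xs [Zz _]]; first by exists f.
  exact: ZP.
exists Z => // v z Vv Zz.
have [->|v0] := eqVneq v 0; first by rewrite normr0 mulr_ge0.
have {}v0 : 0 < `|v| by rewrite normr_gt0.
pose u := `|v|^-1 *: v; pose w := `|v|^-1 *: z.
have Vu : V u by exact: subspace_setZ.
have nu : `|u| = 1 by rewrite normrZ normfV normr_id mulVf // gt_eqF.
have sZ := fcod_subspace fZ.
have Zw : Z w by exact: subspace_setZ.
suff uw : 1 <= 2 * `|u + w|.
  move: uw; rewrite /u /w -scalerDr normrZ normfV normr_id mulrCA.
  by rewrite ler_pdivlMl // mulr1.
have [x xs ux] := sP _ Vu ltac:(by rewrite nu).
have [f [fb f1] [fx fw]] := ZP _ _ xs Zw.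
have := le_trans (ler_norm _) (f1 (u + w) I); rewrite blinD // fw addr0.
have := le_trans (ler_norm _) (f1 (x - u) I); rewrite blinB // fx.
have := ler_normD (u - x) x; rewrite subrK nu [`|x - u|]distrC.
by lra.
Qed.

End finite_dimension.

(** * Operators without good extensions *)

Section non_extendable.
Context (R : realType) (X : normedModType R).

Definition not_extendable (E : set X) (t : X -> X) (lambda : R) : Prop :=
  forall T : X -> X, linear_on setT T -> bounded_on setT lambda T ->
    (forall x, E x -> T x = t x) -> False.

Definition non_ufo_in (A B : set X) : Prop :=
  forall lambda, exists E t, [/\ fdim E, E `<=` A, linear_on E t,
    forall x, E x -> B (t x) /\ `|t x| <= `|x| &
    not_extendable E t lambda].

Lemma not_extendable_norm E t (l : R) : not_extendable E t `|l| ->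
  not_extendable E t l.
Proof.
move=> nE T Tl Tb; apply: nE => // x _; apply: le_trans (Tb x I) _.
by rewrite ler_wpM2r // ler_norm.
Qed.

(* If the restriction of t to the kernel of f has an extension T, then t - T
   has rank one and extends by Hahn-Banach, hence so does t. *)
Lemma non_ufo_ker_dom A B (f : X -> R) : bounded_linear f -> non_ufo_in A B ->
  non_ufo_in (A `&` [set x | f x = 0]) B.
Proof.
(* An extension T of norm |l| plus a correction of norm 1 + |l|, the bound on t - T, has norm at
   most 2 |l| + 1. *)
move=> fb bad l; have [E [t [fE EA tl tb nE]]] := bad (2 * `|l| + 1).
have sE := fdim_subspace fE; have sK := subspace_ker fb.
exists (E `&` [set x | f x = 0]), t; split.
- by apply: (fdim_sub fE) => [|x []//]; exact: subspace_setI.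
- by move=> x [/EA Ax fx].
- by move=> a x y [Ex _] [Ey _]; exact: tl.
- by move=> x [/tb].
- apply: not_extendable_norm => T Tl Tb Tt.
  pose u x := t x - T x.
  have ub x : E x -> `|u x| <= (1 + `|l|) * `|x|.
    move=> Ex; apply: le_trans (ler_normB _ _) _; rewrite mulrDl mul1r lerD //.
      by case: (tb x Ex).
    exact: Tb.
  have lT : 0 <= 2 * `|l| + 1 by rewrite addr_ge0 // mulr_ge0.
  have [f0|] := pselect (forall x, E x -> f x = 0).
    apply: (nE T) => //.
      move=> x _; apply: le_trans (Tb x I) _; rewrite ler_wpM2r //.
      by have := normr_ge0 l; lra.
    by move=> x Ex; apply: Tt; split => //; exact: f0.
  move=> /existsNP[e0 /not_implyP[Ee0 /eqP fe0]].
  pose e := (f e0)^-1 *: e0.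
  have Ee : E e by exact: subspace_setZ.
  have fe : f e = 1 by rewrite /e (blinZ fb); exact: mulVf.
  have uE x : E x -> u x = f x *: u e.
    move=> Ex; have Eu : E (x - f x *: e).
      by apply: subspace_setB => //; exact: subspace_setZ.
    have : u (x - f x *: e) = 0.
      rewrite /u Tt ?subrr //; split => //=.
      rewrite (blinB fb) (blinZ fb) fe; apply/eqP; rewrite subr_eq0 eq_sym.
      by apply/eqP; exact: mulr1.
    rewrite /u (linear_onB sE tl) ?(linear_onZ sE tl) //; last exact: subspace_setZ.
    rewrite (linear_onB (@subspace_setT _ _) Tl) // (linear_onZ (@subspace_setT _ _) Tl) //.
    move=> H; apply/eqP; rewrite -subr_eq0 -[X in _ == X]H; apply/eqP.
    vring R X.
  (* The Hahn-Banach bound below divides by |u e|; when u e = 0, T already extends t. *)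
  have [ue|ue] := eqVneq (u e) 0.
    apply: (nE T) => //.
      move=> x _; apply: le_trans (Tb x I) _; rewrite ler_wpM2r //.
      by have := normr_ge0 l; lra.
    by move=> x Ex; apply/esym/eqP; rewrite -subr_eq0 -/(u x) uE // ue scaler0.
  have ue0 : 0 < `|u e| by rewrite normr_gt0.
  have [||||g [gl gb] gf] := @hahn_banach R X E f ((1 + `|l|) / `|u e|).
  + by rewrite divr_ge0 // addr_ge0.
  + exact: sE.
  + exact: blin_sub.
  + move=> x Ex; rewrite mulrAC ler_pdivlMr // -normrZ -uE //; exact: ub.
  apply: (nE (fun x => T x + g x *: u e)).
  + by move=> a x y _ _; rewrite Tl // gl //; vcoefs R X; rewrite /GRing.scale /=; ring.
  + move=> x _; apply: le_trans (ler_normD _ _) _.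
    have -> : (2 * `|l| + 1) * `|x| = `|l| * `|x| + (1 + `|l|) * `|x| by ring.
    apply: lerD; first exact: Tb.
    rewrite normrZ; apply: le_trans (ler_wpM2r _ (gb x I)) _ => //.
    by rewrite mulrAC divfK // gt_eqF.
  + by move=> x Ex; rewrite gf // -uE // /u addrC subrK.
Qed.

(* Projecting the range of t to the kernel of f changes t by an operator of
   rank one, which extends by Hahn-Banach. *)
Lemma non_ufo_ker_ran A B (f : X -> R) : subspace_set B -> bounded_linear f ->
  non_ufo_in A B -> non_ufo_in A (B `&` [set x | f x = 0]).
Proof.
move=> sB fb bad.
have [f0|] := pselect (forall x, B x -> f x = 0).
  move=> l; have [E [t [fE EA tl tb nE]]] := bad l.
  exists E, t; split => // x Ex; have [Bt tx] := tb x Ex.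
  by split => //; split => //; exact: f0.
move=> /existsNP[z0 /not_implyP[Bz0 /eqP fz0]] l.
pose z := (f z0)^-1 *: z0.
have Bz : B z by exact: subspace_setZ.
have fz : f z = 1 by rewrite /z (blinZ fb); exact: mulVf.
have [M M0 fM] := blin_bound fb.
pose K := M * `|z|; have K0 : 0 <= K by rewrite mulr_ge0 // ltW.
have K1 : 0 < 1 + K by rewrite ltr_pwDl.
(* The projected operator has norm at most 1 + K and is divided by that; undoing this costs the
   factor 1 + K on |l|, and the rank one correction adds K. *)
have [E [t [fE EA tl tb nE]]] := bad ((1 + K) * `|l| + K).
have sE := fdim_subspace fE.
exists E, (fun x => (1 + K)^-1 *: (t x - f (t x) *: z)); split => //.
- move=> a x y Ex Ey; rewrite tl // (blinP fb).
  by vcoefs R X; rewrite /GRing.scale /=; ring.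
- move=> x Ex; have [Bt tx] := tb x Ex; split; first split.
  + apply: subspace_setZ => //; apply: subspace_setB => //.
    exact: subspace_setZ.
  + rewrite /= (blinZ fb) (blinB fb) (blinZ fb) fz.
    by rewrite (_ : f (t x) *: 1 = f (t x)) ?subrr ?scaler0 //; exact: mulr1.
  + rewrite normrZ normfV gtr0_norm // ler_pdivrMl //.
    apply: le_trans (ler_normB _ _) _; rewrite mulrDl mul1r lerD //.
    rewrite normrZ /K mulrAC ler_wpM2r // (le_trans (fM _)) // ler_wpM2l //.
    exact: ltW.
- apply: not_extendable_norm => T Tl Tb Tt.
  have [||||g [gl gb] gf] := @hahn_banach R X E (f \o t) M.
  + exact: ltW.
  + exact: sE.
  + by move=> a x y Ex Ey; rewrite /= tl // (blinP fb).
  + move=> x Ex; apply: le_trans (fM _) _; rewrite ler_pM2l //.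
    by case: (tb x Ex).
  apply: (nE (fun x => (1 + K) *: T x + g x *: z)).
  + by move=> a x y _ _; rewrite Tl // gl //; vcoefs R X; rewrite /GRing.scale /=; ring.
  + move=> x _; apply: le_trans (ler_normD _ _) _.
    rewrite mulrDl lerD // normrZ; last by rewrite /K mulrAC ler_wpM2r // gb.
    rewrite gtr0_norm // -mulrA ler_pM2l //; exact: Tb.
  + move=> x Ex; rewrite Tt // gf //= scalerA mulfV ?gt_eqF // scale1r.
    exact: subrK.
Qed.

(** A functional controls the last coordinate and induction the rest. This makes [opnorm t] finite
    when the failure of [UFO] is unfolded. *)
Lemma fdim_bounded (V : set X) (W : normedModType R) (f : X -> W) : fdim V ->
  linear_on V f -> exists2 M, 0 <= M & bounded_on V M f.
Proof.
elim=> [fl|{}V e fV IH Ve fl].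
  exists 0 => // _ ->; rewrite (linear_on0 (@subspace_set_zero _ _) fl).
  by rewrite !normr0 mulr0.
have sV := fdim_subspace fV; have sVe := subspace_addline e sV.
have VVe := @subset_addline _ _ V e; have Vee := mem_addline e sV.
have [|N N0 fN] := IH.
  by move=> a x y Vx Vy; apply: fl; exact: VVe.
have [h [hb hV he]] := separating_functional sV (fdim_closed fV) Ve.
have [M M0 hM] := blin_bound hb.
exists (N * (1 + M * `|e|) + M * `|f e|).
  have Me : 0 <= M * `|e| by rewrite mulr_ge0 // ltW.
  by rewrite addr_ge0 // mulr_ge0 // ?addr_ge0 // ltW.
move=> _ [v [c [Vv ->]]]; set x := v + c *: e.
have hE : h x = c.
  by rewrite /x (blinD hb) (blinZ hb) hV // he add0r; exact: mulr1.
have cM : `|c| <= M * `|x| by rewrite -hE.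
have vM : `|v| <= (1 + M * `|e|) * `|x|.
  have -> : v = x - c *: e by rewrite /x addrK.
  apply: le_trans (ler_normB _ _) _; rewrite mulrDl mul1r lerD // normrZ.
  by rewrite mulrAC ler_wpM2r.
rewrite {1}/x (linear_onD fl); [|exact: VVe|exact: subspace_setZ].
rewrite (linear_onZ sVe fl) //; apply: le_trans (ler_normD _ _) _.
rewrite mulrDl lerD //.
  by apply: le_trans (fN _ Vv) _; rewrite -mulrA ler_wpM2l.
by rewrite normrZ mulrAC ler_wpM2r.
Qed.

Lemma lsubspace_subspace (E : lsubspace X) : subspace_set (lsubspace_set E).
Proof.
case: E => E [E0 El]; split; first exact/set_mem.
by move=> a x y Ex Ey; apply/set_mem/El; exact/mem_set.
Qed.

(** Passes from bundled operators on [sub_space E] to total functions and divides t by its norm. The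
    constant 1 + |l| meets the requirement lambda >= 1. *)
Lemma non_ufo_setT : ~ UFO X -> non_ufo_in (setT : set X) setT.
Proof.
move=> nU l; pose l' := 1 + `|l|.
have l'0 : 0 < l' by rewrite ltr_pwDl.
have /existsNP[E /not_implyP[fE /existsNP[t nT]]] : ~ forall E : lsubspace X,
    finite_dimensional E -> forall t : {linear sub_space E -> X},
    exists2 T : {linear X -> X}, forall x : sub_space E, T (sub_incl x) = t x &
      (opnorm T <= l'%:E * opnorm t)%E.
  by move=> H; apply: nU; exists l' => //; rewrite lerDl.
have /fdim_finite_dimensional fdE := fE; have sE := fdim_subspace fdE.
(* Vectors outside E are sent to 0, which makes [t'] total. *)
pose j (x : X) : sub_space E := insubd 0 x.
have jK x : lsubspace_set E x -> sub_incl (j x) = x.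
  by move=> Ex; apply: (@insubdK _ _ (sub_space E)); rewrite inE.
have jl a x y : lsubspace_set E x -> lsubspace_set E y ->
    j (a *: x + y) = a *: j x + j y.
  move=> Ex Ey; apply: val_inj; rewrite [LHS]jK; last by case: sE => _; apply.
  by rewrite linearP /=; congr (_ *: _ + _); rewrite jK.
pose t' x := t (j x).
have t'l : linear_on (lsubspace_set E) t'.
  by move=> a x y Ex Ey; rewrite /t' jl // linearP.
have Esub (y : sub_space E) : lsubspace_set E (sub_incl y).
  by have := valP y; rewrite inE.
have t'E (y : sub_space E) : t' (sub_incl y) = t y.
  by congr (t _); apply: val_inj; rewrite [LHS]jK.
have [M M0 tM] := fdim_bounded fdE t'l.
have ub : ubound [set `|t y|%:E | y in [set y : sub_space E | `|y| <= 1]] M%:E.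
  move=> _ [y /= y1 <-]; rewrite lee_fin -t'E.
  by apply: le_trans (tM _ (Esub y)) _; rewrite ler_piMr.
have [m m0 mE] : exists2 m, 0 <= m & opnorm t = m%:E.
  have oM : (opnorm t <= M%:E)%E by exact: ge_ereal_sup.
  have o0 : (0 <= opnorm t)%E.
    apply: ereal_sup_ubound; exists 0; first by rewrite /= normr0.
    by rewrite linear0 normr0.
  case: (opnorm t) oM o0 => // m _; rewrite lee_fin => m0.
  by exists m.
have tm : bounded_on (lsubspace_set E) m t'.
  move=> x Ex; have [->|x0] := eqVneq x 0.
    by rewrite (linear_on0 sE t'l) !normr0 mulr0.
  have {}x0 : 0 < `|x| by rewrite normr_gt0.
  have : (`|t (j (`|x|^-1 *: x))|%:E <= opnorm t)%E.
    apply: ereal_sup_ubound; exists (j (`|x|^-1 *: x)) => //=.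
    rewrite /Num.norm /= jK; last exact: subspace_setZ.
    by rewrite normrZ normfV normr_id mulVf // gt_eqF.
  rewrite mE lee_fin -/(t' _) (linear_onZ sE t'l) // normrZ normfV normr_id.
  by rewrite ler_pdivrMl // mulrC.
have nE : not_extendable (lsubspace_set E) t' (l' * m).
  move=> T Tl Tb Tt; apply: nT.
  pose TL : {linear X -> X} := HB.pack T
    (GRing.isLinear.Build R X X _ T (fun a x y => Tl a x y I I)).
  exists TL; first by move=> y; rewrite /= Tt.
  rewrite mE -EFinM; apply: ge_ereal_sup => _ [x /= x1 <-].
  rewrite lee_fin; apply: le_trans (Tb x I) _.
  by rewrite ler_piMr // mulr_ge0 // ltW.
(* If t has norm 0 the zero operator extends it, a contradiction; so its norm can be divided out. *)
have [m00|{}m0] : m = 0 \/ 0 < m by move: m0; rewrite le_eqVlt => /predU1P[->|]; [left|right].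
  exfalso; apply: (nE (fun=> 0)).
  - by move=> a x y _ _; rewrite scaler0 addr0.
  - by move=> x _; rewrite m00 mulr0 mul0r normr0.
  - move=> x Ex; apply/esym/eqP; rewrite -normr_le0.
    by have := tm x Ex; rewrite m00 mul0r.
exists (lsubspace_set E), (fun x => m^-1 *: t' x); split => //.
- by move=> a x y Ex Ey; rewrite t'l //; vring R X.
- move=> x Ex; split => //; rewrite normrZ normfV gtr0_norm // ler_pdivrMl //.
  exact: tm.
- move=> T Tl Tb Tt; apply: (nE (fun x => m *: T x)).
  + by move=> a x y _ _; rewrite Tl //; vring R X.
  + move=> x _; rewrite normrZ gtr0_norm // [l' * m]mulrC -mulrA ler_pM2l //.
    apply: le_trans (Tb x I) _; rewrite ler_wpM2r //.
    by apply: le_trans (ler_norm _) _; rewrite lerDr.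
  + by move=> x Ex; rewrite Tt // scalerA mulfV ?gt_eqF // scale1r.
Qed.

Lemma non_ufo_fcod (Z : set X) : ~ UFO X -> fcod Z -> non_ufo_in Z Z.
Proof.
move=> nU; elim=> [|{}Z f fZ IH fb]; first exact: non_ufo_setT.
apply: non_ufo_ker_ran => //; first exact: fcod_subspace.
exact: non_ufo_ker_dom.
Qed.

End non_extendable.

(** * The inductive construction *)

Section construction.
Context (R : realType) (X : normedModType R).

(* sH contains all vectors chosen so far, and later domains and ranges are
   chosen in sZ; sQ projects sH + sZ onto sH. *)
Record state := State { sZ : set X; sH : set X; sQ : X -> X }.

(** [gs_norming] bounds [sQ] by 2 on sH + sZ, whatever its norm on X. *)
Record good_state (s : state) : Prop := GoodState {
  gs_Z : fcod (sZ s);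
  gs_H : fdim (sH s);
  gs_Q : bounded_linear (sQ s);
  gs_QH : forall x, sH s x -> sQ s x = x;
  gs_QZ : forall x, sZ s x -> sQ s x = 0;
  gs_norming : forall x y, sH s x -> sZ s y -> `|x| <= 2 * `|x + y|
}.

Record stage := Stage {
  gF : set X; gS : X -> X; gphi : X -> R; gz : X
}.

(** [ns_phiZ] makes the functional vanish on later domains and ranges, while [ns_zH] places z where
    all later functionals vanish; the latter yields triangularity. *)
Record next_stage (lambda eps : R) (s : state) (g : stage) (s' : state) :
    Prop := NextStage {
  ns_good : good_state s';
  ns_H : sH s `<=` sH s';
  ns_Z : sZ s' `<=` sZ s;
  ns_sF : subspace_set (gF g);
  ns_FZ : gF g `<=` sZ s;
  ns_FH : gF g `<=` sH s';
  ns_S : bounded_linear (gS g);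
  ns_SZ : forall x, gF g x -> sZ s (gS g x);
  ns_SH : forall x, gF g x -> sH s' (gS g x);
  ns_Sb : bounded_on (gF g) eps (gS g);
  ns_nx : not_extendable (gF g) (gS g) lambda;
  ns_phi : bounded_linear (gphi g);
  ns_phiH : forall x, sH s x -> gphi g x = 0;
  ns_phiF : forall x, gF g x -> gphi g x = 0;
  ns_phiS : forall x, gF g x -> gphi g (gS g x) = 0;
  ns_phiZ : forall x, sZ s' x -> gphi g x = 0;
  ns_phiz : gphi g (gz g) = 1;
  ns_zH : sH s' (gz g)
}.

Lemma next_stage_exists (lambda eps : R) (s : state) :
  ~ fdim [set: X] -> ~ UFO X -> 0 < eps -> good_state s ->
  exists g s', next_stage lambda eps s g s'.
Proof.
move=> dimX nU e0 gs; have sZs := fcod_subspace (gs_Z gs).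
(* Multiplication of t by [eps] turns [eps^-1 * lambda] into [lambda]. *)
have [F [t [fF FZ tl tb nF]]] := non_ufo_fcod nU (gs_Z gs) (eps^-1 * lambda).
have sF := fdim_subspace fF.
have [QF QFb [QFF QFid _]] := fdim_projection fF.
pose S x := eps *: t (QF x).
have SF x : F x -> S x = eps *: t x by move=> Fx; rewrite /S QFid.
have Sb : bounded_linear S.
  apply: (@blin_scale _ _ _ eps (t \o QF)); split.
    by move=> a x y _ _; rewrite /= (blinP QFb) tl.
  have [M M0 QM] := blin_bound QFb; exists M; first exact: ltW.
  by move=> x _; apply: le_trans (QM x); case: (tb _ (QFF x)).
pose H1 := addset (addset (sH s) F) (S @` F).
have fSF : fdim (S @` F) by apply: fdim_image => //; exact: blin_sub.
have fH1 : fdim H1 by apply: fdim_addset => //; apply: fdim_addset => //; exact: gs_H gs.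
have H0 := subspace_set0 (fdim_subspace (gs_H gs)).
have F0 := subspace_set0 sF; have SF0 := subspace_set0 (fdim_subspace fSF).
have HH1 : sH s `<=` H1.
  move=> x Hx; exists x, 0; split; rewrite ?addr0 //.
  by exists x, 0; rewrite addr0.
have FH1 : F `<=` H1.
  move=> x Fx; exists x, 0; split; rewrite ?addr0 //.
  by exists 0, x; rewrite add0r.
have SH1 : forall x, F x -> H1 (S x).
  move=> x Fx; exists 0, (S x).
  by split; [exists 0, 0; rewrite addr0|exists x|rewrite add0r].
have [z H1z] : exists z, ~ H1 z.
  apply: contrapT => /forallNP H1T; apply: dimX.
  suff -> : [set: X] = H1 by [].
  by apply/seteqP; split => // x _; apply: contrapT; exact: H1T.
have [phi [phib phiH1 phiz]] :=
  separating_functional (fdim_subspace fH1) (fdim_closed fH1) H1z.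
pose H' := addline H1 z; have fH' : fdim H' by exact: fdim_step.
have H1H' : H1 `<=` H' by exact: subset_addline.
have [Z1 fZ1 nZ1] := fdim_norming fH'.
have [Q Qb [_ Qid [Z2 fZ2 QZ2]]] := fdim_projection fH'.
(* [sZ s] nests the stages, [Z1] gives the norming inequality for [H'], [Z2] is killed by [Q], and
   the last factor makes [phi] vanish on later domains and ranges. *)
pose Z' := (sZ s `&` Z1 `&` Z2) `&` [set x | phi x = 0].
exists (Stage F S phi z), (State Z' H' Q); split => //=.
- split => //=.
  + apply: fcod_ker => //; apply: fcodI => //; apply: fcodI => //.
    exact: gs_Z gs.
  + by move=> x [[_ Z2x] _]; exact: QZ2.
  + by move=> x y Hx [[[_ Z1y] _] _]; exact: nZ1.
- by move=> x /HH1/H1H'.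
- by move=> x [[[]]].
- by move=> x /FH1/H1H'.
- by move=> x Fx; rewrite SF //; apply: subspace_setZ => //; case: (tb _ Fx).
- by move=> x /SH1/H1H'.
- move=> x Fx; rewrite SF // normrZ gtr0_norm // ler_pM2l //.
  by case: (tb _ Fx).
- move=> T Tl Tb TS; apply: (nF (fun x => eps^-1 *: T x)).
  + by move=> a x y _ _; rewrite Tl //; vring R X.
  + move=> x _; rewrite normrZ normfV gtr0_norm // -mulrA ler_pM2l ?invr_gt0 //.
    exact: Tb.
  + by move=> x Fx; rewrite TS // SF // scalerA mulVf ?gt_eqF // scale1r.
- by move=> x /HH1/phiH1.
- by move=> x /FH1/phiH1.
- by move=> x /SH1/phiH1.
- by move=> x [].
- exact/mem_addline/fdim_subspace.
Qed.

(* r n is the operator s_n P_n; the phi n witness infinite codimension. *)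
Record rigid_system (Y : set X) (F : nat -> set X) (r : nat -> X -> X)
    (phi : nat -> X -> R) (z : nat -> X) : Prop := RigidSystem {
  rs_Y : subspace_set Y;
  rs_closed : metric_closed Y;
  rs_FY : forall n, F n `<=` Y;
  rs_r : forall n, bounded_linear (r n);
  rs_bound : forall n, bounded_on Y (2^-1 ^+ n.+2) (r n);
  rs_off : forall m n y, m != n -> F n y -> r m y = 0;
  rs_nx : forall n, not_extendable (F n) (r n) n%:R;
  rs_ker : forall n, exists2 Z, fcod Z & forall x, Z x -> r n x = 0;
  rs_phi : forall n, bounded_linear (phi n);
  rs_phiY : forall n y, Y y -> phi n y = 0;
  rs_phir : forall m n y, Y y -> phi n (r m y) = 0;
  rs_phiz : forall n, phi n (z n) = 1;
  rs_triangular : forall m n, (n < m)%N -> phi m (z n) = 0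
}.

Lemma rigid_system_exists : ~ fdim [set: X] -> ~ UFO X ->
  exists Y F r phi z, rigid_system Y F r phi z.
Proof.
move=> dimX nU.
pose eps n : R := 2^-1 ^+ n.+4.
have h0 : 0 < 2^-1 :> R by rewrite invr_gt0.
have e0 n : 0 < eps n by rewrite exprn_gt0.
have g0 : good_state (State setT [set 0] (fun=> 0)).
  split => //=; first exact: fcodT; first exact: fdim_zero.
  - exact: blin_cst0.
  - by move=> x y -> _; rewrite normr0 mulr_ge0.
(* Pairing each state with its proof of goodness lets [choice] produce a step function that can be
   iterated. *)
have stepP (p : nat * {s | good_state s}) : exists q : stage * {s | good_state s},
    next_stage p.1%:R (eps p.1) (sval p.2) q.1 (sval q.2).
  have [g [s' gs']] := next_stage_exists p.1%:R dimX nU (e0 p.1) (svalP p.2).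
  by exists (g, exist _ s' (ns_good gs')).
have [f fP] := choice stepP.
pose st := fix st n : {s | good_state s} :=
  if n is m.+1 then (f (m, st m)).2 else exist _ _ g0.
pose G n := (f (n, st n)).1.
pose Z n := sZ (sval (st n)); pose H n := sH (sval (st n)).
pose Q n := sQ (sval (st n)).
have gs n : good_state (sval (st n)) := svalP (st n).
have ns n : next_stage n%:R (eps n) (sval (st n)) (G n) (sval (st n.+1)).
  exact: fP (n, st n).
have HS m n : (m <= n)%N -> H m `<=` H n.
  elim: n => [|n IH]; first by rewrite leqn0 => /eqP ->.
  rewrite leq_eqVlt => /predU1P[->//|/IH HH].
  by apply: subset_trans HH _; exact: ns_H (ns n).
have ZS m n : (m <= n)%N -> Z n `<=` Z m.
  elim: n => [|n IH]; first by rewrite leqn0 => /eqP ->.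
  rewrite leq_eqVlt => /predU1P[->//|/IH ZZ].
  by apply: subset_trans ZZ; exact: ns_Z (ns n).
have sHn n : subspace_set (H n) := fdim_subspace (gs_H (gs n)).
have sZn n : subspace_set (Z n) := fcod_subspace (gs_Z (gs n)).
pose F n := gF (G n); pose phi n := gphi (G n); pose z n := gz (G n).
pose S n := gS (G n).
have FH m n : (m < n)%N -> F m `<=` H n.
  by move=> mn x Fx; apply: (HS _ _ mn); exact: (ns_FH (ns m)).
have FZ m n : (m <= n)%N -> F n `<=` Z m.
  by move=> mn x Fx; apply: (ZS _ _ mn); exact: (ns_FZ (ns n)).
have phiH m n x : (m <= n)%N -> H m x -> phi n x = 0.
  by move=> mn Hx; apply: (ns_phiH (ns n)); exact: HS Hx.
have phiZ m n x : (m < n)%N -> Z n x -> phi m x = 0.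
  by move=> mn Zx; apply: (ns_phiZ (ns m)); exact: ZS Zx.
(* Earlier blocks are killed because they lie in [H m], later ones because they lie in [Z m.+1]. *)
have phiF m n x : F n x -> phi m x = 0.
  move=> Fx; have [nm|mn|mn] := ltngtP n m.
  - by apply: (phiH _ _ _ (leqnn _)); exact: (FH n).
  - by apply: (phiZ _ _ _ mn); exact: (FZ n n).
  - by rewrite -mn; exact: (ns_phiF (ns n)).
have phiS m n x : F n x -> phi m (S n x) = 0.
  move=> Fx; have [nm|mn|mn] := ltngtP n m.
  - by apply: (phiH _ _ _ nm); exact: (ns_SH (ns n)).
  - by apply: (phiZ _ _ _ mn); exact: (ns_SZ (ns n)).
  - by rewrite -mn; exact: (ns_phiS (ns n)).
have phib n : bounded_linear (phi n) := ns_phi (ns n).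
have Qb n : bounded_linear (Q n) := gs_Q (gs n).
have QH m n x : (m <= n)%N -> H m x -> Q n x = x.
  by move=> mn Hx; apply: (gs_QH (gs n)); exact: HS Hx.
have QZ m n x : (m <= n)%N -> Z n x -> Q m x = 0.
  by move=> mn Zx; apply: (gs_QZ (gs m)); exact: ZS Zx.
(* On y = a + b + c in H_n + F_n + Z_(n+1), the difference of projections is (a + b) - a = b, which
   is P_n y. *)
pose r n x := S n (Q n.+1 x - Q n x).
have rb n : bounded_linear (r n).
  apply: (@blin_comp _ _ _ _ (fun x => Q n.+1 x - Q n x) (S n)).
    exact: blin_sub2.
  exact: ns_S (ns n).
pose D n := addset (addset (H n) (F n)) (Z n.+1).
(* Constraints take the place of a span: every [F n] satisfies them, and the bounds and vanishing
   they entail pass to the closure. *)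
pose Y1 := [set y | forall n, phi n y = 0 /\ D n y].
have sY1 : subspace_set Y1.
  have sD n : subspace_set (D n).
    by do 2?apply: subspace_addset => //; exact: ns_sF (ns n).
  split=> [n|a x y Yx Yy n]; first by split; [exact: blin0|exact: subspace_set0].
  have [px Dx] := Yx n; have [py Dy] := Yy n; split.
    by rewrite (blinP (phib n)) px py scaler0 addr0.
  by case: (sD n) => _; apply.
(* Since b = (a + b) - a, norming [H n.+1] against c and [H n] against b + c gives 2 + 2 = 4. *)
have rD n y : D n y -> exists b, [/\ F n b, r n y = S n b & `|b| <= 4 * `|y|].
  move=> [_ [c [[a [b [Ha Fb ->]]] Zc ->]]]; exists b; split => //.
    rewrite /r !(blinD (Qb _)) (QH n n.+1) // (QH n.+1 n.+1) //; last exact: (FH n).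
    rewrite (QZ n.+1 n.+1) // (QH n n) // (QZ n n b) //; last exact: (FZ _ n).
    by rewrite (QZ n n.+1) // !addr0 [a + b]addrC addrK.
  have Hab : H n.+1 (a + b).
    by apply: subspace_setD => //; [exact: HS Ha|exact: (FH n)].
  have Zbc : Z n (b + c).
    by apply: subspace_setD => //; [exact: (FZ _ n)|exact: ZS Zc].
  have := gs_norming (gs n.+1) Hab Zc; have := gs_norming (gs n) Ha Zbc.
  have := ler_normB (a + b) a; rewrite addrA [X in `|X - a|]addrC addrK.
  by lra.
have FY1 n : F n `<=` Y1.
  move=> y Fy m; split; first exact: phiF Fy.
  have H0 := subspace_set0 (sHn m); have Z0 := subspace_set0 (sZn m.+1).
  have F0 := subspace_set0 (ns_sF (ns m)).
  have [nm|mn|mn] := ltngtP n m.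
  - exists y, 0; split; rewrite ?addr0 //; exists y, 0; split; rewrite ?addr0 //.
    exact: (FH n).
  - exists 0, y; split; rewrite ?add0r //; last exact: (FZ _ n).
    by exists 0, 0; rewrite addr0.
  - exists y, 0; split; rewrite ?addr0 //; exists 0, y; split; rewrite ?add0r //.
    by rewrite -mn.
exists (closure_of Y1), F, r, phi, z; split => //.
- exact: subspace_closure_of.
- exact: closure_of_closed.
- by move=> n y Fy; apply: subset_closure_of; exact: FY1 Fy.
- move=> n; apply: closure_of_bounded => //.
  move=> y /(_ n)[_ /rD[b [Fb -> by4]]].
  have -> : 2^-1 ^+ n.+2 = eps n * 4 by rewrite /eps !exprS; field.
  apply: le_trans (ns_Sb (ns n) Fb) _.
  by apply: le_trans (ler_wpM2l (ltW (e0 n)) by4) _; rewrite mulrA.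
- move=> m n y mn Fy.
  have Sm0 : S m 0 = 0 by exact: (blin0 (ns_S (ns m))).
  (* An earlier block lies in [H m], where both projections are the identity; a later one lies in
     [Z m.+1], where both vanish. *)
  rewrite /r; case: (ltngtP n m) mn => // nm _.
    rewrite (QH m m.+1) //; last exact: (FH n).
    by rewrite (QH m m) ?subrr //; exact: (FH n).
  rewrite (QZ m.+1 n) //; last exact: (FZ _ n).
  rewrite (QZ m n) ?subrr //; [exact: ltnW|exact: (FZ _ n)].
- move=> n T Tl Tb Tr; apply: (ns_nx (ns n) Tl Tb) => x Fx; rewrite Tr // /r.
  rewrite (QH n.+1 n.+1) //; last exact: (FH n).
  by rewrite (QZ n n) ?subr0 //; exact: (FZ _ n).
- move=> n; exists (Z n.+1); first exact: gs_Z (gs _).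
  move=> x Zx; rewrite /r (QZ n.+1 n.+1) // (QZ n n.+1) // subrr.
  exact: (blin0 (ns_S (ns n))).
- by move=> n y; apply: (closure_of_ker (phib n)) => x /(_ n)[].
- move=> m n y; apply: (@closure_of_ker _ _ _ (phi n \o r m)).
    exact: blin_comp.
  by move=> x /(_ m)[_ /rD[b [Fb /= -> _]]]; exact: phiS Fb.
- by move=> n; exact: ns_phiz (ns n).
- by move=> m n nm; apply: (phiH n.+1) => //; exact: ns_zH (ns n).
Qed.

End construction.

(** * Automorphisms extending finite rank perturbations *)

Section geometric.
Context (R : realType).

Lemma half_pow_small (C eps : R) : 0 < eps -> exists m, C * 2^-1 ^+ m < eps.
Proof.
move=> e0; exists (Num.bound `|C / eps|); set N := Num.bound _.
have N2 : (0 : R) < 2 ^+ N by rewrite exprn_gt0.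
rewrite exprVn ltr_pdivrMr // mulrC -ltr_pdivrMr //.
apply: le_lt_trans (ler_norm _) _; apply: lt_le_trans (archi_boundP _) _ => //.
by rewrite -natrX ler_nat ltnW // ltn_expl.
Qed.

Lemma half_pow_eq (X : normedModType R) (x y : X) (C : R) :
  (forall m, `|x - y| <= C * 2^-1 ^+ m) -> x = y.
Proof.
move=> H; apply/eqP; rewrite -subr_eq0 -normr_le0; apply/ler_addgt0Pr => e e0.
have [m Cm] := half_pow_small C e0.
by rewrite add0r (le_trans (H m)) // ltW.
Qed.

Lemma half_pow_ge0 m : 0 <= (2^-1 : R) ^+ m.
Proof. by rewrite exprn_ge0 // invr_ge0. Qed.

Lemma half_pow_antitone m n : (m <= n)%N -> (2^-1 : R) ^+ n <= 2^-1 ^+ m.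
Proof.
move=> mn; apply: ler_wiXn2l => //.
by rewrite invf_le1 // ler1n.
Qed.

Lemma cauchy_limit (X : completeNormedModType R) (u : nat -> X) (b : nat -> R) :
  (forall m n, (m <= n)%N -> `|u n - u m| <= b m) ->
  (forall eps, 0 < eps -> exists m, b m < eps) ->
  exists l, forall m, `|l - u m| <= b m.
Proof.
move=> ub b0; have cu : cvgn u.
  apply: cauchy_cvg; apply: cauchy_exP => e e0; have [m bm] := b0 _ e0.
  exists (u m); exists m => // n /= mn; rewrite -ball_normE /= distrC.
  exact: le_lt_trans (ub _ _ mn) bm.
exists (limn u) => m; apply/ler_addgt0Pr => e e0.
have /cvgrPdist_lt/(_ _ e0)[N _ uN] := cu.
have := uN (maxn m N) (leq_maxr _ _); have := ub _ _ (leq_maxl m N).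
set v := u (maxn m N) => vm /= lv.
apply: le_trans (ler_distD v _ _) _.
by rewrite addrC lerD // ltW.
Qed.

End geometric.

Section automorphisms.
Context (R : realType) (X : completeNormedModType R).

(** The lower bound makes preimages of approximants a Cauchy sequence, whose limit lies in V and
    maps to the given point. *)
Lemma image_closed (V : set X) (U : X -> X) (c M : R) : subspace_set V ->
  metric_closed V -> linear_on V U -> 0 < c -> 0 <= M -> bounded_on V M U ->
  (forall v, V v -> c * `|v| <= `|U v|) -> metric_closed (U @` V).
Proof.
move=> sV cV Ul c0 M0 UM Uc w wU.
have h0 m : 0 < (2^-1 : R) ^+ m by rewrite exprn_gt0 // invr_gt0.
have /choice[v vP] : forall m, exists v, V v /\ `|w - U v| < 2^-1 ^+ m.
  by move=> m; have [_ [v Vv <-] wv] := wU _ (h0 m); exists v.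
(* From c |v n - v m| <= 2^-n + 2^-m <= 2 * 2^-m for m <= n. *)
pose b m := (2 / c) * 2^-1 ^+ m.
have [||l lP] := @cauchy_limit R X v b.
- move=> m n mn; have [Vm wm] := vP m; have [Vn wn] := vP n.
  rewrite /b mulrAC ler_pdivlMr // mulrC.
  apply: le_trans (Uc _ (subspace_setB sV Vn Vm)) _; rewrite (linear_onB sV Ul) //.
  apply: le_trans (ler_distD w _ _) _; rewrite [`|U _ - w|]distrC.
  by have := @half_pow_antitone R _ _ mn; lra.
- by move=> e e0; exact: half_pow_small.
have Vl : V l.
  apply: cV => e e0; have [m bm] := half_pow_small (2 / c) e0.
  by exists (v m); [case: (vP m)|exact: le_lt_trans (lP m) bm].
exists l => //; apply: (@half_pow_eq R _ _ _ (1 + M * (2 / c))) => m.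
have [Vm /ltW wm] := vP m; apply: le_trans (ler_distD (U (v m)) _ _) _.
rewrite -(linear_onB sV Ul) // [`|U _ - w|]distrC mulrDl mul1r addrC lerD //.
apply: le_trans (UM _ (subspace_setB sV Vl Vm)) _.
by rewrite -mulrA ler_wpM2l.
Qed.

Definition automorphism (A : X -> X) : Prop :=
  exists B, [/\ bounded_linear A, bounded_linear B, cancel A B & cancel B A].

Lemma automorphism_id : automorphism id.
Proof. by exists id; split => //; exact: blin_id. Qed.

Lemma automorphism_comp A A' : automorphism A -> automorphism A' ->
  automorphism (A' \o A).
Proof.
move=> [B [Ab Bb AB BA]] [B' [A'b B'b AB' BA']]; exists (B \o B'); split.
- exact: blin_comp.
- exact: blin_comp.
- exact: can_comp.
- exact: can_comp.
Qed.

(** The inverse is given by the Sherman-Morrison formula. *)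
Lemma automorphism_rank1 (f : X -> R) (w : X) : bounded_linear f ->
  1 + f w != 0 -> automorphism (fun x => x + f x *: w).
Proof.
move=> fb fw; exists (fun x => x - (f x / (1 + f w)) *: w); split.
- by apply: blin_add; [exact: blin_id|exact: blin_rank1].
- apply: blin_sub2; first exact: blin_id.
  apply: blin_rank1; under eq_fun do rewrite mulrC.
  exact: (@blin_scale _ _ _ (1 + f w)^-1 f fb).
- move=> x; rewrite (blinD fb) (blin_scalar fb).
  by vcoefs R X; field.
- move=> x; rewrite (blinB fb) (blin_scalar fb).
  by vcoefs R X; field.
Qed.

(** If f kills V and f x = 1, then y + f y (x' - x) fixes V and sends x to x'; it is invertible when
    f x' is nonzero, as 1 + f (x' - x) = f x'. Should f x' vanish, a functional g with g x' = 1 is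
    added to f or, rescaled, replaces it. *)
Lemma automorphism_move (V : set X) (x x' : X) : subspace_set V ->
  metric_closed V -> ~ V x -> ~ V x' ->
  exists A, [/\ automorphism A, forall v, V v -> A v = v & A x = x'].
Proof.
move=> sV cV Vx Vx'.
have [f [fb fV fx fx']] : exists f : X -> R,
    [/\ bounded_linear f, forall v, V v -> f v = 0, f x = 1 & f x' != 0].
  have [f [fb fV fx]] := separating_functional sV cV Vx.
  have [fx'|fx'] := eqVneq (f x') 0; last by exists f.
  have [g [gb gV gx']] := separating_functional sV cV Vx'.
  have [gx|gx] := eqVneq (g x) 0.
    exists (fun y => f y + g y); split; first exact: blin_add.
    - by move=> v Vv; rewrite fV // gV // addr0.
    - by rewrite fx gx addr0.
    - by rewrite fx' gx' add0r oner_neq0.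
  exists (fun y => (g x)^-1 *: g y); split; first exact: blin_scale.
  - by move=> v Vv; rewrite (gV _ Vv); exact: mulr0.
  - exact: mulVf.
  - rewrite gx' [_ *: _]mulr1 invr_eq0; exact: gx.
exists (fun y => y + f y *: (x' - x)); split.
- apply: automorphism_rank1 => //.
  by rewrite (blinB fb) fx addrC subrK.
- by move=> v Vv; rewrite fV // scale0r addr0.
- by rewrite fx scale1r addrC subrK.
Qed.

(* T and U are matched one dimension at a time; injectivity of T and U keeps
   the new vectors out of the closed subspace already matched. *)
Lemma automorphism_extension (Z : set X) : fcod Z ->
  forall (Y : set X) (T U : X -> X) (c M : R), subspace_set Y ->
  metric_closed Y -> linear_on Y T -> linear_on Y U -> 0 < c -> 0 <= M ->
  bounded_on Y M U -> (forall y, Y y -> c * `|y| <= `|T y|) ->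
  (forall y, Y y -> c * `|y| <= `|U y|) ->
  (forall y, Y y -> Z y -> T y = U y) ->
  exists2 A, automorphism A & forall y, Y y -> A (T y) = U y.
Proof.
elim=> [|{}Z f fZ IH fb] Y T U c M sY cY Tl Ul c0 M0 UM Tc Uc TU.
  exists id; first exact: automorphism_id.
  by move=> y Yy; exact: TU.
pose Y' := Y `&` [set x | f x = 0].
have sY' : subspace_set Y' by apply: subspace_setI => //; exact: subspace_ker.
have cY' : metric_closed Y'.
  move=> x xY'; split.
    by apply: cY => e e0; have [v [Yv _] xv] := xY' _ e0; exists v.
  by apply: (closure_of_ker fb _ xY') => v [].
have Ul' : linear_on Y' U by move=> a x y [Yx _] [Yy _]; exact: Ul.
have [|||||A1 A1a A1T] := IH Y' T U c M sY' cY' _ Ul' c0 M0.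
- by move=> a x y [Yx _] [Yy _]; exact: Tl.
- by move=> x [/UM].
- by move=> x [/Tc].
- by move=> x [/Uc].
- by move=> x [Yx fx] Zx; exact: TU.
have [f0|] := pselect (forall y, Y y -> f y = 0).
  by exists A1 => // y Yy; apply: A1T; split => //; exact: f0.
move=> /existsNP[d0 /not_implyP[Yd0 /eqP fd0]].
pose d := (f d0)^-1 *: d0.
have Yd : Y d by exact: subspace_setZ.
have fd : f d = 1 by rewrite /d (blinZ fb); exact: mulVf.
have Y'E y : Y y -> Y' (y - f y *: d).
  move=> Yy; split; first by apply: subspace_setB => //; exact: subspace_setZ.
  by rewrite /= (blinB fb) (blinZ fb) fd /GRing.scale /= mulr1 subrr.
have Yin (S : X -> X) : linear_on Y S -> (forall y, Y y -> c * `|y| <= `|S y|) ->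
    forall y y', Y y -> Y y' -> S y = S y' -> y = y'.
  move=> Sl Sc y y' Yy Yy' Syy'; apply/eqP; rewrite -subr_eq0 -normr_le0.
  rewrite -(ler_pM2l c0) mulr0; apply: le_trans (Sc _ (subspace_setB sY Yy Yy')) _.
  by rewrite (linear_onB sY Sl) // Syy' subrr normr0.
have nY' y : Y' y -> y <> d.
  by move=> [_ /= fy] yd; move: fy; rewrite yd fd => /eqP; rewrite oner_eq0.
have cU : metric_closed (U @` Y').
  by apply: (image_closed sY' cY' Ul' c0 M0) => y [Yy _]; [exact: UM|exact: Uc].
have sU : subspace_set (U @` Y').
  split; first by exists 0; [exact: subspace_set0|exact: (linear_on0 sY Ul)].
  move=> a _ _ [x Y'x <-] [y Y'y <-]; exists (a *: x + y); last exact: Ul'.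
  by case: sY' => _; apply.
have [B1 [A1b B1b A1B1 B1A1]] := A1a.
(* [A2] fixes the image of Y' pointwise, so it preserves what [A1] has matched and only corrects the
   direction [d]. *)
have [||A2 [A2a A2U A2d]] := @automorphism_move (U @` Y') (A1 (T d)) (U d) sU cU.
- move=> [y Y'y Uy]; apply: (nY' _ Y'y); have [Yy _] := Y'y.
  apply: (Yin T Tl Tc) => //; apply: (can_inj A1B1).
  by rewrite A1T.
- by move=> [y Y'y Uy]; apply: (nY' _ Y'y); have [Yy _] := Y'y; exact: (Yin U).
exists (A2 \o A1); first exact: automorphism_comp.
have [B2 [A2b _ _ _]] := A2a.
move=> y Yy; have -> : y = (y - f y *: d) + f y *: d by rewrite subrK.
have Yfd : Y (f y *: d) by exact: subspace_setZ.
have [Yyd _] := Y'E _ Yy.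
rewrite /= (linear_onD Tl) // (linear_onD Ul) // (blinD A1b) (blinD A2b).
rewrite A1T; last exact: Y'E.
rewrite A2U; last by exists (y - f y *: d) => //; exact: Y'E.
congr (_ + _).
by rewrite (linear_onZ sY Tl) // (linear_onZ sY Ul) // (blinZ A1b) (blinZ A2b) A2d.
Qed.

End automorphisms.

(** * Linear dependence and infinite codimension *)

Section dependence.
Context (R : realType) (X : normedModType R).

Lemma dependent_family (N : nat) (c : 'I_N.+1 -> 'I_N -> R) :
  exists2 u : 'I_N.+1 -> R, (exists i, u i != 0) &
    forall j, \sum_i u i * c i j = 0.
Proof.
pose A := \matrix_(i, j) c i j.
have : kermx A != 0.
  rewrite kermx_eq0; apply/negP => /eqP fA.
  by have := rank_leq_col A; rewrite fA ltnn.
move=> /rowV0Pn[v /sub_kermxP vA v0].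
exists (fun i => v 0 i).
  apply: contrapT => /forallNP v0'; move/eqP: v0; apply.
  by apply/rowP => i; rewrite mxE; apply/eqP/negP => /negP; exact: v0'.
move=> j; have := congr1 (fun B : 'rV_N => B 0 j) vA.
by rewrite !mxE => H; rewrite -[RHS]H; apply: eq_bigr => i _; rewrite !mxE.
Qed.

Lemma blin_sum (W : normedModType R) (f : X -> W) (N : nat) (c : 'I_N -> R)
    (e : 'I_N -> X) : bounded_linear f ->
  f (\sum_i c i *: e i) = \sum_i c i *: f (e i).
Proof.
move=> fb; rewrite (big_morph f (blinD fb) (blin0 fb)).
by apply: eq_bigr => i _; exact: blinZ.
Qed.

(** The phi_i act on the quotient by V; if N classes spanned it, some nontrivial combination of N +
    1 of them would vanish on X. Evaluating it at z_0, z_1, ... in turn kills all its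
    coefficients. *)
Lemma triangular_not_finite_codimensional (V : set X) (phi : nat -> X -> R)
    (z : nat -> X) : (forall n, bounded_linear (phi n)) ->
  (forall n v, V v -> phi n v = 0) -> (forall n, phi n (z n) = 1) ->
  (forall m n, (n < m)%N -> phi m (z n) = 0) -> ~ finite_codimensional V.
Proof.
move=> phib phiV phiz phi0 [N [e eV]].
have [u [i0 ui0] uc] := dependent_family (fun (i : 'I_N.+1) j => phi i (e j)).
have psi0 x : \sum_(i < N.+1) u i * phi i x = 0.
  have [v Vv [c _ xv]] := eV x.
  have phix (i : 'I_N.+1) : phi i x = \sum_j c j * phi i (e j).
    rewrite -[x](subrK v) -xv (blinD (phib i)) (phiV i v Vv) addr0.
    exact: blin_sum.
  under eq_bigr do rewrite phix mulr_sumr.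
  rewrite exchange_big big1 //= => j _.
  under eq_bigr do rewrite mulrCA.
  by rewrite -mulr_sumr uc mulr0.
have u0 (k : nat) (i : 'I_N.+1) : (i < k)%N -> u i = 0.
  elim: k i => // k IH i ik.
  have := psi0 (z i); rewrite (bigD1 i) //= phiz mulr1 big1 ?addr0 // => j ji.
  have [lt_ji|lt_ij|eq_ij] := ltngtP j i.
  - by rewrite IH ?mul0r // (leq_trans lt_ji).
  - by rewrite phi0 ?mulr0.
  - by move: ji; rewrite (val_inj eq_ij) eqxx.
by move: ui0; rewrite (u0 N.+1) // eqxx.
Qed.

End dependence.

(** * The operators indexed by the Cantor space *)

Section perturbations.
Context (R : realType) (X : completeNormedModType R).
Variables (Y : set X) (F : nat -> set X) (r : nat -> X -> X).
Variables (phi : nat -> X -> R) (z : nat -> X).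
Hypothesis rs : rigid_system Y F r phi z.

Let psum (a : nat -> bool) (m : nat) (y : X) : X :=
  \sum_(n < m) (a n)%:R *: r n y.

Let psumS a m y : psum a m.+1 y = psum a m y + (a m)%:R *: r m y.
Proof. by rewrite /psum big_ord_recr. Qed.

Let psum_lin a m b x y :
  psum a m (b *: x + y) = b *: psum a m x + psum a m y.
Proof.
rewrite /psum scaler_sumr -big_split; apply: eq_bigr => i _ /=.
by rewrite (blinP (rs_r rs i)); vring R X.
Qed.

Lemma perturbation_limit (a : nat -> bool) (y : X) : Y y ->
  exists l, forall m,
    `|l - \sum_(n < m) (a n)%:R *: r n y| <= `|y| * 2^-1 ^+ m.+1.
Proof.
move=> Yy; apply: (@cauchy_limit R X (fun m => psum a m y)) => [m n mn|e e0].
  (* The exact difference of tails telescopes, whereas [2^-1 ^+ m.+1] alone would not pass through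
     the induction. *)
  suff : `|psum a n y - psum a m y| <= `|y| * (2^-1 ^+ m.+1 - 2^-1 ^+ n.+1).
    move=> H; apply: le_trans H _; rewrite ler_wpM2l // lerBlDr lerDl.
    exact: half_pow_ge0.
  elim: n mn => [|n IH]; first by rewrite leqn0 => /eqP ->; rewrite !subrr normr0 mulr0.
  rewrite leq_eqVlt => /predU1P[->|]; first by rewrite !subrr normr0 mulr0.
  move=> /IH {}IH; rewrite psumS addrAC.
  apply: le_trans (ler_normD _ _) _; rewrite normrZ.
  have rn := rs_bound rs n Yy.
  have an : `|(a n)%:R : R| * `|r n y| <= `|r n y|.
    by rewrite ler_piMl //; case: (a n); rewrite ?normr1 ?normr0.
  have e2 : (2^-1 : R) ^+ n.+1 = 2^-1 ^+ n.+2 + 2^-1 ^+ n.+2.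
    by rewrite [X in X + _]exprS [X in _ + X]exprS; field.
  move: IH rn; rewrite e2 !mulrBr mulrDr.
  by set p := 2^-1 ^+ n.+2; set q := _ ^+ m.+1; rewrite (mulrC p); lra.
have [m ym] := half_pow_small `|y| e0; exists m; apply: le_lt_trans ym.
by rewrite ler_wpM2l // half_pow_antitone.
Qed.

Variable K : (nat -> bool) -> X -> X.
Hypothesis KP : forall a y, Y y -> forall m,
  `|K a y - \sum_(n < m) (a n)%:R *: r n y| <= `|y| * 2^-1 ^+ m.+1.

Let KP' a y m : Y y -> `|K a y - psum a m y| <= `|y| * 2^-1 ^+ m.
Proof.
move=> Yy; apply: le_trans (KP a Yy m) _.
by rewrite ler_wpM2l // half_pow_antitone.
Qed.

(** Comparison from index n on suffices, as partial sums on a block become constant once its term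
    has been added. *)
Let Kuniq a y l C n : Y y ->
  (forall m, (n <= m)%N -> `|l - psum a m y| <= C * 2^-1 ^+ m) -> K a y = l.
Proof.
move=> Yy lP; apply: (@half_pow_eq R _ _ _ (`|y| + `|C|)) => m.
have C0 : C <= `|C| by exact: ler_norm.
apply: le_trans (ler_distD (psum a (n + m) y) _ _) _.
rewrite [X in _ + X]distrC mulrDl lerD //.
  apply: le_trans (KP' _ _ Yy) _; rewrite ler_wpM2l //.
  exact/half_pow_antitone/leq_addl.
apply: le_trans (lP _ (leq_addr _ _)) _.
apply: le_trans (ler_wpM2r (half_pow_ge0 _ _) C0) _; rewrite ler_wpM2l //.
exact/half_pow_antitone/leq_addl.
Qed.

Lemma perturbation_linear a : linear_on Y (K a).
Proof.
move=> b x y Yx Yy.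
apply: (@Kuniq _ _ _ (`|b| * `|x| + `|y|) 0) => [|m _].
  by case: (rs_Y rs) => _; apply.
rewrite psum_lin.
have -> : b *: K a x + K a y - (b *: psum a m x + psum a m y) =
    b *: (K a x - psum a m x) + (K a y - psum a m y) by vring R X.
apply: le_trans (ler_normD _ _) _; rewrite mulrDl lerD //; last exact: KP'.
by rewrite normrZ -mulrA ler_wpM2l //; exact: KP'.
Qed.

Lemma perturbation_bound a : bounded_on Y 2^-1 (K a).
Proof.
move=> y Yy; have := KP a Yy 0; rewrite big_ord0 subr0 expr1.
by rewrite mulrC.
Qed.

Lemma perturbation_block a n y : F n y -> K a y = (a n)%:R *: r n y.
Proof.
move=> Fy; apply: (@Kuniq _ _ _ 0 n.+1); first exact: (rs_FY rs Fy).
move=> m nm; rewrite mul0r normr_le0 subr_eq0; apply/eqP.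
rewrite /psum (bigD1 (Ordinal nm)) //= big1 ?addr0 // => i ni.
rewrite (rs_off rs _ Fy) ?scaler0 //.
Qed.

Lemma perturbation_phi a n y : Y y -> phi n (K a y) = 0.
Proof.
move=> Yy; have phib := rs_phi rs n; have [M M0 phiM] := blin_bound phib.
have p0 m : phi n (psum a m y) = 0.
  rewrite /psum (blin_sum _ _ phib) big1 // => i _.
  by rewrite (rs_phir rs _ _ Yy) scaler0.
apply: (@half_pow_eq R _ _ _ (M * `|y|)) => m.
rewrite subr0 -[phi n _]subr0 -(p0 m) -(blinB phib).
by apply: le_trans (phiM _) _; rewrite -mulrA ler_pM2l //; exact: KP'.
Qed.

Lemma perturbation_eq a b m y : Y y -> (forall n, (m <= n)%N -> a n = b n) ->
  (forall n, (n < m)%N -> r n y = 0) -> K a y = K b y.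
Proof.
move=> Yy ab r0; apply: (@Kuniq _ _ _ `|y| 0) => // k _.
suff -> : psum a k y = psum b k y by exact: KP'.
apply: eq_bigr => i _; have [mi|im] := leqP m i; first by rewrite ab.
by rewrite r0 // !scaler0.
Qed.

Lemma perturbation_continuous a b m y : Y y ->
  (forall n, (n < m)%N -> a n = b n) ->
  `|K a y - K b y| <= `|y| * 2^-1 ^+ m.
Proof.
move=> Yy ab; apply: le_trans (ler_distD (psum a m y) _ _) _.
have -> : `|y| * 2^-1 ^+ m = `|y| * 2^-1 ^+ m.+1 + `|y| * 2^-1 ^+ m.+1.
  by rewrite exprS; field.
apply: lerD; first exact: KP.
have -> : psum a m y = psum b m y by apply: eq_bigr => i _; rewrite ab.
by rewrite distrC; exact: KP.
Qed.

End perturbations.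

(** Each F_n contains a vector not killed by r_n, else the zero operator would extend r_n. These
    vectors are independent, because r_k kills all of them but the k-th. *)
Lemma rigid_system_not_finite_dimensional (R : realType) (X : normedModType R)
    (Y : set X) (F : nat -> set X) (r : nat -> X -> X) (phi : nat -> X -> R)
    (z : nat -> X) :
  rigid_system Y F r phi z -> ~ finite_dimensional Y.
Proof.
move=> rs [N [e YE]].
have /choice[f fP] : forall n, exists y, F n y /\ r n y != 0.
  move=> n; apply: contrapT => /forallNP nf.
  have nx : not_extendable (F n) (r n) n%:R by exact: rs_nx rs _.
  apply: (nx (fun=> 0)).
  - by move=> a x y _ _; rewrite scaler0 addr0.
  - by move=> x _; rewrite normr0 mulr_ge0.
  - move=> x Fx; apply/esym/eqP/negP => /negP rx.
    by apply: (nf x).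
have /choice[c cP] : forall n, exists c : 'I_N -> R, \sum_(j < N) c j *: e j = f n.
  move=> n; have [Fn _] := fP n; have := rs_FY rs Fn.
  by rewrite YE => -[c _ <-]; exists c.
have [u [k uk] uc] := dependent_family (fun (i : 'I_N.+1) j => c i j).
have u0 : \sum_(i < N.+1) u i *: f i = 0.
  under eq_bigr do rewrite -cP scaler_sumr.
  rewrite exchange_big big1 //= => j _.
  under eq_bigr do rewrite scalerA.
  by rewrite -scaler_suml uc scale0r.
have := congr1 (r k) u0; rewrite (blin_sum _ _ (rs_r rs k)) (blin0 (rs_r rs k)).
rewrite (bigD1 k) //= big1 ?addr0.
  by move=> /eqP; rewrite scaler_eq0 (negPf uk) /=; case: (fP k) => _ /negPf ->.
move=> i ik; have [Fi _] := fP i.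
by rewrite (rs_off rs _ Fi) ?scaler0 // eq_sym.
Qed.

(** * Non-smoothness of E0 *)

Section cantor.
Implicit Types (x y : cantor_space) (B : set cantor_space).

Definition agree (m : nat) (x y : cantor_space) : Prop :=
  forall i, (i < m)%N -> x i = y i.

Lemma agree_refl m x : agree m x x. Proof. by []. Qed.

Lemma agree_trans m y x z : agree m x y -> agree m y z -> agree m x z.
Proof. by move=> xy yz i im; rewrite xy // yz. Qed.

Lemma agree_le m n x y : (m <= n)%N -> agree n x y -> agree m x y.
Proof. by move=> mn xy i im; rewrite xy // (leq_trans im). Qed.

Lemma open_agree B x : open B -> B x ->
  exists m, forall y, agree m x y -> B y.
Proof.
move=> oB Bx; apply: contrapT => /forallNP nm.
have /choice[u uP] : forall m, exists y, agree m x y /\ ~ B y.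
  by move=> m; have /existsNP[y /not_implyP] := nm m; exists y.
have ux : {ptws, u @ \oo --> x}.
  apply/(@pointwise_cvgP nat bool) => i.
  apply: cvg_near_cst; exists i.+1 => // m /= im.
  by have [xu _] := uP m; rewrite xu.
have nB : nbhs (x : {ptws nat -> bool}) B by exact: open_nbhs_nbhs.
have [N _ uN] := ux _ nB.
by have [_] := uP N; apply; apply: uN => /=.
Qed.

Lemma nbhs_agree m x : nbhs x [set y | agree m x y].
Proof.
elim: m => [|m IH]; first by apply: filterS filterT.
have xm : nbhs x [set y | y m = x m].
  exact: (@proj_continuous nat (fun=> bool) m x _ (discrete_set1 (x m))).
apply: filterS (filterI IH xm) => y [xy ym] i; rewrite ltnS leq_eqVlt.
by move=> /predU1P[->|/xy].
Qed.

Definition dense_open (D : set cantor_space) : Prop :=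
  (forall x, D x -> exists m, forall y, agree m x y -> D y) /\
  (forall x m, exists2 y, agree m x y & D y).

Lemma dense_openI D E : dense_open D -> dense_open E -> dense_open (D `&` E).
Proof.
move=> [oD dD] [oE dE]; split=> [x [/oD[m mD] /oE[n nE]]|x m].
  exists (maxn m n) => y xy; split; [apply: mD|apply: nE];
    by apply: agree_le xy; rewrite ?leq_maxl ?leq_maxr.
have [y xy Dy] := dD x m; have [n nD] := oD _ Dy.
have [z yz Ez] := dE y (maxn m n); exists z.
  by apply: agree_trans xy _; apply: agree_le yz; rewrite leq_maxl.
by split => //; apply: nD; apply: agree_le yz; rewrite leq_maxr.
Qed.

Lemma baire_cantor (D : nat -> set cantor_space) (x0 : cantor_space)
    (m0 : nat) : (forall n, dense_open (D n)) ->
  exists2 x, agree m0 x0 x & forall n, D n x.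
Proof.
move=> dD.
have stepP (p : nat * (cantor_space * nat)) : exists q : cantor_space * nat,
    [/\ agree p.2.2 p.2.1 q.1, (p.2.2 < q.2)%N &
        forall z, agree q.2 q.1 z -> D p.1 z].
  case: p => n [x m] /=; have [oD /(_ x m)[y xy Dy]] := dD n.
  (* Taking at least [m.+1] makes prefix lengths grow strictly, so each coordinate is eventually
     fixed. *)
  have [k kD] := oD _ Dy; exists (y, maxn m.+1 k); split => //=.
    by rewrite leq_maxl.
  by move=> z yz; apply: kD; apply: agree_le yz; rewrite leq_maxr.
have [f fP] := choice stepP.
pose s := fix s n := if n is k.+1 then f (k, s k) else (x0, m0).
have sP n : [/\ agree (s n).2 (s n).1 (s n.+1).1, ((s n).2 < (s n.+1).2)%N &
    forall z, agree (s n.+1).2 (s n.+1).1 z -> D n z] := fP (n, s n).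
have sm m n : (m <= n)%N -> ((s m).2 <= (s n).2)%N.
  elim: n => [|n IH]; first by rewrite leqn0 => /eqP ->.
  rewrite leq_eqVlt => /predU1P[->//|/IH mn].
  by have [_ /ltnW sn _] := sP n; exact: leq_trans sn.
have sa m n : (m <= n)%N -> agree (s m).2 (s m).1 (s n).1.
  elim: n => [|n IH]; first by rewrite leqn0 => /eqP ->.
  rewrite leq_eqVlt => /predU1P[->//|]; rewrite ltnS => mn.
  have [sn _ _] := sP n; apply: agree_trans (IH mn) _.
  by apply: agree_le sn; exact: sm.
have sn n : (n <= (s n).2)%N.
  by elim: n => // n IH; have [_ + _] := sP n; exact: leq_ltn_trans.
(* The prefix at stage i + 1 has length at least i + 1 and so decides coordinate i. *)
pose x : cantor_space := fun i => (s i.+1).1 i.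
have xs n : agree (s n).2 (s n).1 x.
  move=> i im; have [ni|/ltnW ni] := leqP n i.+1; first exact: sa.
  by apply/esym/(sa _ _ ni); exact: sn.
exists x; first exact: (xs 0).
by move=> n; have [_ _] := sP n; apply; exact: xs.
Qed.

Definition xor (c x : cantor_space) : cantor_space := fun i => c i (+) x i.

Lemma xorK c x : xor c (xor c x) = x.
Proof. by apply: functional_extensionality_dep => i; rewrite /xor addKb. Qed.

Lemma agree_xor m c x y : agree m x y -> agree m (xor c x) (xor c y).
Proof. by move=> xy i im; rewrite /xor xy. Qed.

Lemma dense_open_xor c D : dense_open D -> dense_open [set x | D (xor c x)].
Proof.
move=> [oD dD]; split=> [x /= /oD[m mD]|x m].
  by exists m => y xy; apply: mD; exact: agree_xor.
have [y xy Dy] := dD (xor c x) m; exists (xor c y); last by rewrite /= xorK.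
by rewrite -[x](xorK c); exact: agree_xor.
Qed.

(** Translation preserves dense open sets, so a point and its translate can be made generic
    together. *)
Lemma baire_cantor_xor (D : nat -> set cantor_space) (c x0 : cantor_space)
    (m0 : nat) : (forall n, dense_open (D n)) ->
  exists x, [/\ agree m0 x0 x, forall n, D n x & forall n, D n (xor c x)].
Proof.
move=> dD.
have [|x x0x Dx] := @baire_cantor (fun n => D n `&` [set x | D n (xor c x)]) x0 m0.
  by move=> n; apply: dense_openI => //; exact: dense_open_xor.
by exists x; split=> // n; have [] := Dx n.
Qed.

(* A form of the Baire property that is visibly stable under complements. *)
Definition almost_clopen B : Prop :=
  exists2 D : nat -> set cantor_space, forall n, dense_open (D n) &
    forall x, (forall n, D n x) -> exists m, forall y, agree m x y ->
      (forall n, D n y) -> (B x <-> B y).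

Lemma dense_open_countable (I : countType) (D : I -> nat -> set cantor_space) :
  (forall i n, dense_open (D i n)) ->
  exists2 E : nat -> set cantor_space, forall n, dense_open (E n) &
    forall x, (forall n, E n x) -> forall i n, D i n x.
Proof.
move=> dD.
exists (fun n => if unpickle n is Some (i, k) then D i k else setT).
  move=> n; case: unpickle => [[i k]|]; first exact: dD.
  by split=> [x _|x m]; [exists 0|exists x].
by move=> x Ex i n; have := Ex (pickle (i, n)); rewrite pickleK.
Qed.

(** The set is the complement of the boundary of U: a cylinder either meets U or misses it
    entirely. *)
Lemma dense_open_boundary (U : set cantor_space) :
  (forall x, U x -> exists m, forall y, agree m x y -> U y) ->
  dense_open [set x | U x \/ exists m, forall y, agree m x y -> ~ U y].
Proof.
move=> oU; split=> [x /= [/oU[m mU]|[m mU]]|x m].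
- by exists m => y /mU; left.
- exists m => y xy; right; exists m => z yz; apply: mU.
  exact: agree_trans yz.
- have [[y [xy Uy]]|ny] := pselect (exists y, agree m x y /\ U y).
    by exists y => //=; left.
  exists x => //=; right; exists m => y xy Uy; apply: ny.
  by exists y.
Qed.

Lemma open_almost_clopen B : open B -> almost_clopen B.
Proof.
move=> oB.
exists (fun=> [set x | B x \/ exists m, forall y, agree m x y -> ~ B y]).
  by move=> _; apply: dense_open_boundary => x; exact: open_agree.
move=> x /(_ 0)[Bx|[m mB]].
  by have [m mB] := open_agree oB Bx; exists m => y /mB By _; split.
by exists m => y /mB nBy _; split=> // Bx; case: (mB x).
Qed.

Lemma almost_clopen_sigma_algebra : sigma_algebra setT almost_clopen.
Proof.
split.
- exact/open_almost_clopen/open0.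
- move=> B [D dD DB]; exists D => // x /DB[m mB]; exists m => y xy Dy.
  have [xB yB] := mB y xy Dy; rewrite setTD.
  by split=> nB B'; apply: nB; [exact: yB|exact: xB].
- move=> B acB.
  have /choice[D DP] : forall k, exists D : nat -> set cantor_space,
      (forall n, dense_open (D n)) /\
      forall x, (forall n, D n x) -> exists m, forall y, agree m x y ->
        (forall n, D n y) -> (B k x <-> B k y).
    by move=> k; have [D dD DB] := acB k; exists D.
  have [|E dE ED] := @dense_open_countable nat D.
    by move=> k; case: (DP k).
  (* U is the open set near whose points a single B k holds generically; a generic point off the
     boundary of U lies in U or in its exterior. *)
  pose U := [set x | exists k m, forall y, agree m x y ->
    (forall n, D k n y) -> B k y].
  have oU x : U x -> exists m, forall y, agree m x y -> U y.
    move=> [k [m mB]]; exists m => y xy; exists k, m => z yz.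
    by apply: mB; exact: agree_trans yz.
  pose W := [set x | U x \/ exists m, forall y, agree m x y -> ~ U y].
  exists (fun n => E n `&` W).
    by move=> n; apply: dense_openI => //; exact: dense_open_boundary.
  move=> x EWx; have Ex n : E n x by case: (EWx n).
  have [_ [[k [m mB]]|[m mU]]] := EWx 0.
    exists m => y xy EWy; have Ey n : E n y by case: (EWy n).
    by split=> _; exists k => //; apply: mB => // n; exact: ED.
  (* A generic y in some B k would lie in U by local constancy of B k. *)
  have nB y : agree m x y -> (forall n, E n y) -> ~ (\bigcup_k B k) y.
    move=> xy Ey [k _ Bky]; apply: (mU y xy).
    have [_ /(_ y (fun n => ED _ Ey k n))[m' mB]] := DP k.
    by exists k, m' => y' yy' Dy'; apply/(mB y' yy' Dy').
  exists m => y xy EWy; have Ey n : E n y by case: (EWy n).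
  by split=> [/(nB x (agree_refl _) Ex)|/(nB y xy Ey)].
Qed.

Lemma borel_almost_clopen B : borel B -> almost_clopen B.
Proof.
apply: smallest_sub => //; first exact: almost_clopen_sigma_algebra.
exact: open_almost_clopen.
Qed.

Lemma E0_not_smooth (R : realType) : ~ smooth R E0.
Proof.
move=> [f fB fE0].
have /choice[D DP] : forall q : rat, exists D : nat -> set cantor_space,
    (forall n, dense_open (D n)) /\
    forall x, (forall n, D n x) -> exists m, forall y, agree m x y ->
      (forall n, D n y) -> (f x < ratr q <-> f y < ratr q).
  move=> q; have [|D dD DB] := @borel_almost_clopen (f @^-1` [set s | s < ratr q]).
    by apply: fB; apply: sub_sigma_algebra; exact: open_lt.
  by exists D.
have [|E dE ED] := @dense_open_countable rat D.
  by move=> q; case: (DP q).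
(* If f separated generic x and y at a rational, a finitely supported translation would take a
   generic point near x to one near y, against invariance under E_0. *)
have fle x y : (forall n, E n x) -> (forall n, E n y) -> f x < f y -> False.
  move=> Ex Ey /rat_in_itvoo[q]; rewrite in_itv /= => /andP[xq qy].
  have [_ DB] := DP q.
  have [m mx] := DB x (fun n => ED _ Ex q n).
  have [k ky] := DB y (fun n => ED _ Ey q n).
  (* Adding [c] takes the cylinder of x to that of y and leaves all coordinates beyond it
     unchanged. *)
  pose c : cantor_space := fun i => if (i < maxn m k)%N then x i (+) y i else false.
  have [w [xw Ew Ecw]] := baire_cantor_xor c x (maxn m k) dE.
  have fw : f w < ratr q.
    apply/(mx w); first by apply: agree_le xw; rewrite leq_maxl.
      by move=> n; exact: ED.
    exact: xq.
  have fcw : ~ f (xor c w) < ratr q.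
    move=> H; suff : f y < ratr q by rewrite ltNge (ltW qy).
    apply/(ky (xor c w)) => //; last by move=> n; exact: ED.
    move=> i ik; have im : (i < maxn m k)%N by rewrite (leq_trans ik) ?leq_maxr.
    by rewrite /xor /c im -(xw i im) addbC addbA addbb.
  apply: fcw; suff <- : f w = f (xor c w) by [].
  apply/fE0; exists (maxn m k) => i im.
  by rewrite /xor /c ltnNge im.
(* This translation flips every coordinate: w and its translate are both generic, so f identifies
   them, yet they agree nowhere. *)
pose c : cantor_space := fun=> true.
have [w [_ Ew Ecw]] := baire_cantor_xor c c 0 dE.
have : f w = f (xor c w).
  by apply/eqP; case: ltgtP => // [/(fle _ _ Ew Ecw)|/(fle _ _ Ecw Ew)].
move=> /fE0[m /(_ m (leqnn m))]; rewrite /xor /c.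
by case: (w m).
Qed.

End cantor.

(** * Embeddings and the reduction *)

Section bounded_operators.
Context (R : realType).

Lemma blin_continuous (Y W : normedModType R) (f : {linear Y -> W}) :
  bounded_linear f -> continuous f.
Proof.
move=> fb; apply/linear_bounded_continuous/linear_boundedP.
have [M M0 fM] := blin_bound fb.
exists M; split; first exact: num_real.
by move=> N /ltW MN x; apply: le_trans (fM x) _; rewrite ler_wpM2r.
Qed.

Lemma bounded_op_blin (Y W : normedModType R) (T : bounded_op Y W) :
  bounded_linear T.
Proof.
split; first by move=> a x y _ _; exact: linearP.
have /linear_bounded_continuous/linear_boundedP[M [_ TM]] :=
  @bounded_op_continuous _ _ _ T.
have M1 : M < `|M| + 1 by rewrite (le_lt_trans (ler_norm M)) // ltrDl.
by exists (`|M| + 1) => [|x _]; [rewrite addr_ge0|exact: TM].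
Qed.

Lemma blin_bounded_op (Y W : normedModType R) (f : Y -> W) :
  bounded_linear f -> exists T : bounded_op Y W, forall y, T y = f y.
Proof.
move=> fb.
pose fL : {linear Y -> W} := HB.pack f
  (GRing.isLinear.Build R Y W _ f (blinP fb)).
by exists (BoundedOp (@blin_continuous Y W fL fb)).
Qed.

Lemma automorphism_isomorphism (X : completeNormedModType R) (A : X -> X) :
  automorphism A -> exists2 T : bounded_op X X, isomorphism T &
    forall x, T x = A x.
Proof.
move=> [B [Ab Bb AB BA]].
have [T TA] := blin_bounded_op Ab; have [S SB] := blin_bounded_op Bb.
by exists T => //; exists S; split=> x; rewrite TA SB.
Qed.

Lemma subspace_submod (X : normedModType R) (V : set X) : subspace_set V ->
  submod_closed (mem V : {pred X}).
Proof.
move=> [V0 Vl]; split; first exact: mem_set.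
by move=> a x y /set_mem Vx /set_mem Vy; apply: mem_set; exact: Vl.
Qed.

Lemma sub_inclP (X : normedModType R) (V : lsubspace X) (v : sub_space V) :
  lsubspace_set V (sub_incl v).
Proof. exact: (set_mem (valP v)). Qed.

Lemma sub_incl_onto (X : normedModType R) (V : lsubspace X) (x : X) :
  lsubspace_set V x -> exists v : sub_space V, sub_incl v = x.
Proof. by move=> /mem_set Vx; exists (SubSpace Vx). Qed.

Lemma sub_incl_linear (X : normedModType R) (V : lsubspace X) (a : R)
    (u v : sub_space V) : sub_incl (a *: u + v) = a *: sub_incl u + sub_incl v.
Proof. exact: (linearP val). Qed.

Lemma sub_incl_inj (X : normedModType R) (V : lsubspace X) :
  injective (@sub_incl R X V).
Proof. exact: val_inj. Qed.

(** The lower bound makes the range closed and the inverse continuous, with norm at most 1/c. *)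
Lemma embedding_bounded_below (X : completeNormedModType R) (Y : lsubspace X)
    (f : X -> X) (c M : R) (T : bounded_op (sub_space Y) X) :
  metric_closed Y -> linear_on Y f -> 0 < c -> 0 <= M -> bounded_on Y M f ->
  (forall y, lsubspace_set Y y -> c * `|y| <= `|f y|) ->
  (forall y, T y = f (sub_incl y)) -> ~ finite_codimensional (f @` Y) ->
  embedding T.
Proof.
move=> cY fl c0 M0 fM fc TE ncod.
have sY := lsubspace_subspace Y.
have sV : subspace_set (f @` Y).
  split; first by exists 0; [exact: subspace_set0|exact: (linear_on0 sY fl)].
  move=> a _ _ [x Yx <-] [y Yy <-]; exists (a *: x + y); last exact: fl.
  by case: sY => _; apply.
pose V := LSubspace (subspace_submod sV).
have VT y : T y \in lsubspace_pred V.
  by apply: mem_set; exists (sub_incl y); [exact: sub_inclP|rewrite TE].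
pose T' y : sub_space V := SubSpace (VT y).
have Tb := bounded_op_blin T.
have Tc y : c * `|y| <= `|T y| by rewrite TE; apply: fc; exact: sub_inclP.
have Tinj y y' : T y = T y' -> y = y'.
  move=> Tyy'; apply/eqP; rewrite -subr_eq0 -normr_le0 -(ler_pM2l c0) mulr0.
  by apply: le_trans (Tc _) _; rewrite (blinB Tb) Tyy' subrr normr0.
have T'b : bounded_linear T'.
  split; first by move=> a x y _ _; apply: sub_incl_inj; rewrite sub_incl_linear /= (blinP Tb).
  by have [N N0 TN] := blin_bound Tb; exists N; [exact: ltW|move=> y _; exact: TN].
have /choice[g gP] : forall v : sub_space V, exists y, T y = sub_incl v.
  move=> v; have [x Yx fx] := sub_inclP v.
  by have [y yx] := sub_incl_onto Yx; exists y; rewrite TE yx.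
have gb : bounded_linear g.
  split.
    move=> a u v _ _; apply: Tinj.
    by rewrite gP sub_incl_linear (blinP Tb) !gP.
  exists c^-1; first by rewrite invr_ge0 ltW.
  move=> v _; rewrite ler_pdivlMl //; apply: le_trans (Tc _) _.
  by rewrite gP.
have [T'' T''E] := blin_bounded_op T'b; have [S SE] := blin_bounded_op gb.
exists V; split => //.
  exact/closedP/(image_closed sY cY fl c0 M0 fM fc).
exists T''; last by move=> y; rewrite T''E.
exists S; split => [y|v]; rewrite SE T''E.
  by apply: Tinj; rewrite gP.
by apply: sub_incl_inj; rewrite /= gP.
Qed.

End bounded_operators.

Lemma continuous_borel_map (E F : topologicalType) (f : E -> F) :
  continuous f -> borel_map f.
Proof.
move=> /continuousP fc; rewrite /borel_map.
apply: (@smallest_sub _ _ _ [set B | borel (f @^-1` B)]); last first.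
  by move=> B oB; apply: sub_sigma_algebra; exact: fc.
have [s0 sC sU] := @smallest_sigma_algebra E setT open.
split => /=.
- by rewrite preimage_set0.
- by move=> B; rewrite setTD preimage_setC -setTD; exact: sC.
- by move=> B sB; rewrite preimage_bigcup; exact: sU.
Qed.

Lemma borel_reducible_smooth (R : realType) (E F : topologicalType)
    (r : E -> E -> Prop) (s : F -> F -> Prop) :
  borel_reducible r s -> smooth R s -> smooth R r.
Proof.
move=> [f fB fP] [g gB gP]; exists (g \o f).
  by move=> B /gB/fB.
by move=> x y; rewrite fP; exact: gP.
Qed.

Section reduction.
Context (R : realType) (X : completeNormedModType R).
Variables (Y : lsubspace X) (F : nat -> set X) (r : nat -> X -> X).
Variables (phi : nat -> X -> R) (z : nat -> X).
Hypothesis rs : rigid_system Y F r phi z.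
Variable K : (nat -> bool) -> X -> X.
Hypothesis KP : forall a y, lsubspace_set Y y -> forall m,
  `|K a y - \sum_(n < m) (a n)%:R *: r n y| <= `|y| * 2^-1 ^+ m.+1.

Let f (a : nat -> bool) (y : X) : X := y + K a y.

Let fl a : linear_on Y (f a).
Proof.
move=> b x y Yx Yy; rewrite /f (perturbation_linear rs KP) //; vring R X.
Qed.

Let fM a : bounded_on Y 2 (f a).
Proof.
move=> y Yy; apply: le_trans (ler_normD _ _) _.
have := perturbation_bound KP a Yy; have := normr_ge0 y; lra.
Qed.

Let fc a y : lsubspace_set Y y -> 2^-1 * `|y| <= `|f a y|.
Proof.
move=> Yy; have := perturbation_bound KP a Yy.
have := ler_normB (f a y) (K a y); rewrite /f addrK; lra.
Qed.

Lemma perturbed_embedding (a : nat -> bool) :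
  exists2 T : bounded_op (sub_space Y) X, embedding T &
    forall y, T y = sub_incl y + K a (sub_incl y).
Proof.
have sY := rs_Y rs.
have fb : bounded_linear (fun y : sub_space Y => f a (sub_incl y)).
  split; last by exists 2 => // y _; apply: fM; exact: sub_inclP.
  by move=> b x y _ _; rewrite sub_incl_linear fl //; exact: sub_inclP.
have [T TE] := blin_bounded_op fb; exists T => //.
have h0 : 0 < (2^-1 : R) by rewrite invr_gt0.
apply: (embedding_bounded_below (rs_closed rs) (@fl a) h0 (ler0n _ _) (@fM a)
  (@fc a) TE).
apply: triangular_not_finite_codimensional.
- exact: rs_phi rs.
- move=> n _ [y Yy <-]; rewrite /f (blinD (rs_phi rs n)).
  by rewrite (rs_phiY rs) // (perturbation_phi rs KP) // addr0.
- exact: rs_phiz rs.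
- exact: rs_triangular rs.
Qed.

Variable T : cantor_space -> Emb (sub_space Y) X.
Hypothesis TE : forall a (y : sub_space Y),
  (val (T a) : bounded_op (sub_space Y) X) y = sub_incl y + K a (sub_incl y).

Lemma perturbed_continuous : continuous T.
Proof.
(* Two initial topologies are unfolded: that of the subset [Emb], then that of pointwise
   convergence. *)
apply: continuous_comp_initial; apply: continuous_comp_initial => a.
apply/pointwise_cvgP => y /=; apply/cvgrPdist_lt => e e0.
have [m ym] := half_pow_small `|y| e0.
apply: filterS (nbhs_agree m a) => b ab /=.
apply: le_lt_trans ym; rewrite !TE opprD addrACA subrr add0r.
by apply: (perturbation_continuous KP) => //; exact: sub_inclP.
Qed.

Lemma E0_position a b : E0 a b -> position (T a) (T b).
Proof.
move=> [m ab].
(* On the common kernel of r_0, ..., r_(m-1) only the tails of a and b count, so the two operators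
   agree there. *)
have [Z fZ rZ] : exists2 Z, fcod Z & forall n x, (n < m)%N -> Z x -> r n x = 0.
  elim: m {ab} => [|m [Z fZ rZ]]; first by exists setT => //; exact: fcodT.
  have [Z' fZ' rZ'] := rs_ker rs m.
  exists (Z `&` Z'); first exact: fcodI.
  move=> n x; rewrite ltnS leq_eqVlt => /predU1P[-> [_ /rZ']//|nm [Zx _]].
  exact: rZ.
have h0 : 0 < (2^-1 : R) by rewrite invr_gt0.
have [|A Aa AT] := @automorphism_extension _ _ _ fZ Y (f b) (f a) 2^-1 2
  (rs_Y rs) (rs_closed rs) (@fl b) (@fl a) h0 (ler0n _ _) (@fM a) (@fc b) (@fc a).
- move=> y Yy Zy; congr (_ + _); apply: (perturbation_eq KP Yy (m := m)).
    by move=> n mn; rewrite ab.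
  by move=> n nm; exact: rZ Zy.
have [A' A'i A'E] := automorphism_isomorphism Aa.
by exists A' => // y; rewrite !TE A'E [RHS]AT //; exact: sub_inclP.
Qed.

(* On F n, an automorphism mapping T b to T a restricts to the identity plus
   r n, so its distance to the identity exceeds n. *)
Let position_block (A : X -> X) (M : R) a b n : bounded_linear A ->
  (forall x, `|A x| <= M * `|x|) ->
  (forall y, lsubspace_set Y y -> f a y = A (f b y)) ->
  a n = true -> b n = false -> n%:R < M + 1.
Proof.
move=> Ab AM AT an bn; rewrite ltNge; apply/negP => Mn.
have nx : not_extendable (F n) (r n) n%:R by exact: rs_nx rs _.
apply: (nx (fun x => A x - x)).
- by move=> c x y _ _; rewrite (blinP Ab); vring R X.
- move=> x _; apply: le_trans (ler_normB _ _) _.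
  have := AM x; have := ler_wpM2r (normr_ge0 x) Mn; lra.
- move=> x Fx; have Yx := rs_FY rs Fx.
  have := AT x Yx; rewrite /f !(perturbation_block rs KP _ Fx) an bn.
  by rewrite scale0r addr0 scale1r => <-; rewrite addrC addKr.
Qed.

Lemma position_E0 a b : position (T a) (T b) -> E0 a b.
Proof.
move=> [A [S [AS SA]] AT].
have Ab := bounded_op_blin A; have Sb := bounded_op_blin S.
have [M M0 AM] := blin_bound Ab; have [N N0 SN] := blin_bound Sb.
have fab y : lsubspace_set Y y -> f a y = A (f b y).
  by move=> /sub_incl_onto[v <-]; rewrite /f -!TE AT.
have fba y : lsubspace_set Y y -> f b y = S (f a y).
  by move=> Yy; rewrite fab // AS.
(* [A] excludes a n = 1, b n = 0 beyond M + 1, and its inverse [S] excludes the reverse beyond N +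
   1. *)
exists (Num.bound (M + N + 1)) => n kn.
have kMN : M + N + 1 < n%:R.
  apply: lt_le_trans (_ : (Num.bound (M + N + 1))%:R <= _); last by rewrite ler_nat.
  by apply: archi_boundP; rewrite !addr_ge0 // ltW.
case an : (a n); case bn : (b n) => //.
  by have := position_block Ab AM fab an bn; lra.
by have := position_block Sb SN fba bn an; lra.
Qed.

End reduction.

Theorem theorem2p7 (R : realType) (X : completeNormedModType R)
    (sepX : separable_space X) (dimX : ~ finite_dimensional [set: X])
    (nUFO : ~ UFO X) :
  exists Y : lsubspace X,
    [/\ closed (lsubspace_set Y),
        ~ finite_dimensional (lsubspace_set Y),
        borel_reducible E0 (@position R (sub_space Y) X) &
        ~ smooth R (@position R (sub_space Y) X)].
Proof.
have ndim : ~ fdim [set: X] by move=> /fdim_finite_dimensional.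
have [Y0 [F [r [phi [z rs]]]]] := rigid_system_exists ndim nUFO.
pose Y := LSubspace (subspace_submod (rs_Y rs)).
have rsY : rigid_system (lsubspace_set Y) F r phi z := rs.
have [K KP] : exists K : (nat -> bool) -> X -> X,
    forall a y, lsubspace_set Y y -> forall m,
    `|K a y - \sum_(n < m) (a n)%:R *: r n y| <= `|y| * 2^-1 ^+ m.+1.
  have /choice[K KP] : forall p : (nat -> bool) * X, exists l,
      lsubspace_set Y p.2 -> forall m,
      `|l - \sum_(n < m) (p.1 n)%:R *: r n p.2| <= `|p.2| * 2^-1 ^+ m.+1.
    (* The limit is taken on Y; elsewhere 0 is a default value. *)
    move=> [a y] /=; have [Yy|nY] := pselect (lsubspace_set Y y); last by exists 0.
    by have [l lP] := perturbation_limit rsY a Yy; exists l.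
  by exists (fun a y => K (a, y)) => a y; exact: KP (a, y).
have /choice[T TE] : forall a : cantor_space, exists T : Emb (sub_space Y) X,
    forall y, (val T : bounded_op _ _) y = sub_incl y + K a (sub_incl y).
  move=> a; have [T eT TE] := perturbed_embedding rsY KP a.
  by exists (exist _ T (mem_set eT)).
have red : borel_reducible E0 (@position R (sub_space Y) X).
  exists T.
    by apply: continuous_borel_map; exact: (@perturbed_continuous _ _ _ _ _ KP _ TE).
  move=> a b; split; first exact: (E0_position rsY KP TE).
  exact: (position_E0 rsY KP TE).
exists Y; split => //.
- exact/closedP/(rs_closed rsY).
- exact: rigid_system_not_finite_dimensional rsY.
- by move=> /(borel_reducible_smooth red); exact: E0_not_smooth.
Qed.
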